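(* Let $d\ge 2$ and let $(\omega_x : x\in\mathbb{Z}^d)$ be i.i.d. random variables taking values in a finite set $\Theta\subset\mathbb{R}$. For $x\in\mathbb{Z}_+^d$ let $\vec\Pi^{(x)}_{\max}$ be the (random) set of maximal paths from $0$ to $x$, i.e. the directed paths from $0$ to $x$ whose weight is maximal among all directed paths from $0$ to $x$. Then for every $\beta>0$ there exists $\delta=\delta(\beta)>0$ (depending also on $d$ and on the distribution of $\omega_0$) such that for every $x\in C_\beta$ with $\|x\|$ large enough, $$\mathbb{P}\big(|\vec\Pi^{(x)}_{\max}|\le 2^{\delta\|x\|}\big)\le \exp(-\delta\|x\|).$$
   Context: For $1\le i\le d$, $e_i\in\mathbb{Z}^d$ is the site with $i$-th coordinate $1$ and all other coordinates $0$. A directed path $\pi$ from $x$ to $y$ is a sequence of sites $x=\pi_1,\dots,\pi_k=y$ of $\mathbb{Z}^d$ with $\pi_{i+1}-\pi_i\in\{e_1,\dots,e_d\}$ for each $1\le i<k$. The weight of $\pi$ is $W_\pi=\sum_{x\in\pi}\omega_x$. $\mathbb{Z}_+$ is the set of nonnegative integers. For $x=(x_1,\dots,x_d)$, $\|x\|=|x_1|+\dots+|x_d|$ is the $\ell^1$ norm. For $\beta>0$, $C_\beta\subset\mathbb{Z}_+^d$ is the set of sites $x=(x_1,\dots,x_d)$ with $0\le x_i\le(1-\beta)\|x\|$ for every $1\le i\le d$. ''For every $x\in C_\beta$ with $\|x\|$ large enough'' means: there is $N$ such that the bound holds for all $x\in C_\beta$ with $\|x\|\ge N$. $|A|$ denotes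 the cardinality of a set $A$. *)

(* Defs.v *)
From HB Require Import structures.
From mathcomp Require Import all_boot all_order all_algebra finmap.
From mathcomp Require Import all_classical all_reals all_analysis.

Set Implicit Arguments.
Unset Strict Implicit.
Unset Printing Implicit Defensive.

Import Order.TTheory GRing.Theory Num.Theory.
Import numFieldNormedType.Exports.

Local Open Scope classical_set_scope.
Local Open Scope ring_scope.

Definition site (n : nat) := 'rV[int]_n.

Definition step (n : nat) : rel (site n) :=
  fun x y => [exists i, y - x == delta_mx 0 i].

Definition directed_path (n : nat) (x y : site n) (s : seq (site n)) : bool :=
  if s is z :: s' then [&& z == x, path (@step n) z s' & last z s' == y]
  else false.

(* Sites of a directed path are pairwise distinct, so summing over the sequence
   counts each site of the path once. *)
Definition path_weight (n : nat) (R : realType) (w : site n -> R)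
    (s : seq (site n)) : R :=
  \sum_(z <- s) w z.

Definition maximal_paths (n : nat) (R : realType) (w : site n -> R)
    (x : site n) : set (seq (site n)) :=
  [set s | directed_path 0 x s /\
     forall s', directed_path 0 x s' -> path_weight w s' <= path_weight w s].

(* fset_set A is the finite set A when A is finite, and the empty set
   otherwise; finite_maximal_paths below shows that A is finite here. *)
Definition nb_maximal_paths (n : nat) (R : realType) (w : site n -> R)
    (x : site n) : nat :=
  #|` fset_set (maximal_paths w x)|%fset.

Definition l1norm (n : nat) (x : site n) : nat := (\sum_i `|x ord0 i|)%N.

Definition cone (n : nat) (R : realType) (beta : R) : set (site n) :=
  [set x : site n | forall i, 0 <= x ord0 i /\
     (x ord0 i)%:~R <= (1 - beta) * (l1norm x)%:R].

Definition mutually_independent (d : measure_display) (T : measurableType d)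
    (R : realType) (P : probability T R) (I : choiceType)
    (X : I -> {RV P >-> R}) : Prop :=
  forall (J : {fset I}) (B : I -> set R),
    (forall i, i \in J -> measurable (B i)) ->
    P (\bigcap_(i in [set` J]) (X i @^-1` B i)) =
    (\prod_(i <- J) P (X i @^-1` B i))%E.

Definition coord_sum (n : nat) (x : site n) : int := \sum_i x ord0 i.

Lemma coord_sum_step (n : nat) (x y : site n) :
  step x y -> coord_sum y = coord_sum x + 1.
Proof.
case/existsP=> i /eqP h; rewrite -[y](subrK x) h /coord_sum.
under eq_bigr => j _ do rewrite mxE mxE eqxx /=.
rewrite big_split /= addrC; congr (_ + _).
rewrite (bigD1 i) //= eqxx big1 ?addr0 // => j /negbTE; by rewrite eq_sym => ->.
Qed.

Lemma coord_sum_path (n : nat) (x : site n) (s : seq (site n)) :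
  path (@step n) x s -> coord_sum (last x s) = coord_sum x + (size s)%:Z.
Proof.
elim: s x => [|y s IH] x /=; first by rewrite addr0.
case/andP=> /coord_sum_step h /IH ->; by rewrite h -addrA -PoszD add1n.
Qed.

Lemma finite_step_path (n : nat) (x : site n) (k : nat) :
  finite_set [set s | path (@step n) x s /\ size s = k].
Proof.
elim: k x => [|k IH] x.
  by apply: (@sub_finite_set _ _ [set [::]]) => // -[|? ?] [].
apply: (@sub_finite_set _ _ (\bigcup_(i in [set: 'I_n])
  (cons (x + delta_mx 0 i) @`
     [set s | path (@step n) (x + delta_mx 0 i) s /\ size s = k]))).
  move=> [|y s] [] //= /andP[/existsP[i /eqP h] ps] [sk].
  have e : x + delta_mx 0 i = y by rewrite -h addrC subrK.
  by exists i => //; rewrite e; exists s.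
by apply: bigcup_finite => [|i _]; [exact: finite_finset|exact: finite_image].
Qed.

Lemma finite_directed_path (n : nat) (x y : site n) :
  finite_set [set s | directed_path x y s].
Proof.
apply: (@sub_finite_set _ _ (cons x @` [set s | path (@step n) x s /\
  size s = `|coord_sum y - coord_sum x|%N])).
  move=> [|z s] //= /and3P[/eqP -> ps /eqP ls]; exists s => //; split => //.
  by rewrite -ls (coord_sum_path ps) addrAC subrr add0r.
by apply: finite_image; exact: finite_step_path.
Qed.

Lemma finite_maximal_paths (n : nat) (R : realType) (w : site n -> R)
    (x : site n) : finite_set (maximal_paths w x).
Proof.
by apply: sub_finite_set (finite_directed_path 0 x) => s [].
Qed.

(* Main.v *)
Require Import Defs.
From mathcomp Require Import all_boot all_order all_algebra finmap.
From mathcomp Require Import all_classical all_reals all_analysis.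
From mathcomp Require Import zify ring lra.

(** Only the weights of the finitely many sites between 0 and x matter, so the
   statement is about a product measure on functions from a box to the atoms of
   mu (le_prob_cylinders, sum_configs), and a directed path is the word of its
   steps (nb_maximal_path_of). Weights are shifted so that their smallest value
   is 0 and their largest value is D. If D = 0 every path is maximal and there
   are exponentially many of them; from now on D > 0.

   Let m be the norm of x. The geodesic is the lexicographically least maximal
   word. Words are cut into blocks of L letters, L being a large constant. A tie
   is an ascent of the geodesic, that is two consecutive steps i < j, such that
   exchanging these two steps does not change the weight. Ties in different
   blocks can be used independently, so k blocks with a tie give 2 ^ k maximal
   paths (nmax_ntied). It remains to see that it is exponentially unlikely that
   only a small proportion of the blocks have a tie.

   This follows from a multi-valued map (Ex_tied_eligible). Around an ascent of
   the geodesic, carve the environment: give weight D to the geodesic and to the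
   fourth corner of the unit square at the ascent, and weight 0 to all the other
   sites nearby. This creates a tie. The geodesic stays the same (isbest_carve):
   a path through the raised corner either meets the geodesic on both sides
   nearby, and then it gains nothing and is lexicographically larger, or it
   crosses a whole block at weight 0. In the latter case it loses more than the
   D that it wins, provided that this block could be crossed with a weight larger
   than D in the original environment, which is expressed by saying that a window
   is not poor. As the geodesic can be read off the carved environment, so can
   the carved region, up to the choice of the blocks, and an environment has
   few preimages: the price is a bounded factor for each carved block
   (fibre_Pr). On the other hand an environment with N eligible blocks has 2 ^ N
   images, and the blocks that are carved are found among the tied blocks of the
   image. Hence environments with many eligible blocks and few tied ones have an
   exponentially small probability (prob_few_ties).

   There are linearly many eligible blocks (many_eligible), for three reasons.
   A path that zigzags between two long coordinates of x, which exist because x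
   is in the cone, and picks the better site at each corner is heavier than the
   mean by a linear amount, hence so is the geodesic (prob_light). Words whose
   blocks are sorted in nonincreasing order are so few, (L + 1) ^ n for each
   block, that none of them is that heavy (prob_heavy); the geodesic therefore
   differs from its own sorted version and has ascents in linearly many blocks.
   Finally a window is poor with a probability exponentially small in L, which
   beats the polynomial number of its possible positions, so that only a small
   proportion of the blocks have a poor neighbour (prob_poor). *)

Set Implicit Arguments.
Unset Strict Implicit.
Unset Printing Implicit Defensive.

Import Order.TTheory GRing.Theory Num.Theory.
Import numFieldNormedType.Exports.

(** * Paths as words *)

Section Words.
Variables (n m : nat) (i0 : 'I_n).
Notation word := (m.-tuple 'I_n).

(** A path with m steps that starts at the origin is the word of its directions;
   it stays in the box [0, m]^n, which makes the set of sites finite. *)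
Definition vertex := {ffun 'I_n -> 'I_m.+1}.

Definition letter (w : word) (j : nat) : 'I_n := nth i0 w j.

Definition cnt (w : word) (t : nat) (i : 'I_n) : nat := count_mem i (take t w).

Definition pos (w : word) (t : nat) : vertex := [ffun i => inord (cnt w t i)].

Definition level (y : vertex) : nat := \sum_i y i.

Lemma cnt0 w i : cnt w 0 i = 0. Proof. by rewrite /cnt take0. Qed.

Lemma cntS w t i : t < m -> cnt w t.+1 i = cnt w t i + (letter w t == i).
Proof.
move=> tm; rewrite /cnt (take_nth i0) ?size_tuple// -cats1 count_cat /=.
by rewrite addn0.
Qed.

Lemma cnt_oversize w t i : m <= t -> cnt w t i = cnt w m i.
Proof. by move=> mt; rewrite /cnt !take_oversize ?size_tuple. Qed.

Lemma cnt_le w s t i : s <= t -> cnt w s i <= cnt w t i <= cnt w s i + (t - s).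
Proof.
move=> st; rewrite -{1 2}(subnKC st).
elim: (t - s) => [|r IH]; first by rewrite !addn0 leqnn.
rewrite addnS; case: (ltnP (s + r) m) => h; first by rewrite cntS//; case: eqP; lia.
by move: IH; rewrite (@cnt_oversize w (s + r).+1) ?leqW// (@cnt_oversize w (s + r))//; lia.
Qed.

Lemma pos_cntE w t i : pos w t i = cnt w t i :> nat.
Proof.
rewrite ffunE inordK// ltnS -[m in _ <= m](size_tuple w).
by apply: leq_trans (count_size _ _) _; rewrite size_take_min geq_minr.
Qed.

Lemma pos_eqP v s w t : reflect (cnt v s =1 cnt w t) (pos v s == pos w t).
Proof.
apply: (iffP eqP) => [e i|e]; first by rewrite -!pos_cntE e.
by apply/ffunP => i; apply/val_inj; rewrite /= !pos_cntE.
Qed.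

Lemma level_pos w t : t <= m -> level (pos w t) = t.
Proof.
rewrite /level; under eq_bigr do rewrite pos_cntE.
elim: t => [|t IH] tm; first by under eq_bigr do rewrite cnt0; rewrite big1.
under eq_bigr do rewrite cntS//.
rewrite big_split /= IH 1?ltnW// (bigD1 (letter w t))//= eqxx big1 ?addn0 ?addn1//.
by move=> i /negbTE; rewrite eq_sym => ->.
Qed.

Lemma pos_inj v w s t : s <= m -> t <= m -> pos v s = pos w t -> s = t.
Proof. by move=> sm tm /(congr1 level); rewrite !level_pos. Qed.

Lemma pos0 v w : pos v 0 = pos w 0.
Proof. by apply/eqP/pos_eqP => i; rewrite !cnt0. Qed.

Lemma pos_step v w s t : s < m -> t < m ->
  pos v s = pos w t -> letter v s = letter w t -> pos v s.+1 = pos w t.+1.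
Proof.
by move=> sm tm /eqP/pos_eqP e l; apply/eqP/pos_eqP => i; rewrite !cntS// e l.
Qed.

Lemma pos_agree v w a b : b <= m -> pos v a = pos w a ->
  (forall j, a <= j < b -> letter v j = letter w j) ->
  forall j, a <= j <= b -> pos v j = pos w j.
Proof.
move=> bm ea el j /andP[aj jb]; rewrite -(subnKC aj).
have: j - a <= b - a by lia.
elim: (j - a) => [|r IH] h; first by rewrite addn0.
by rewrite addnS; apply: pos_step; [lia|lia|apply: IH; lia|apply: el; lia].
Qed.

Lemma letter_inj v w : (forall j, j < m -> letter v j = letter w j) -> v = w.
Proof. by move=> h; apply: (@eq_from_tnth _ _ v w) => j; rewrite !(tnth_nth i0); apply: h. Qed.

Definition near (y p : vertex) (r : nat) : bool :=
  [forall i, (y i <= p i + r) && (p i <= y i + r)].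

Lemma near_pos w s t r : s <= t + r -> t <= s + r -> near (pos w s) (pos w t) r.
Proof.
move=> h1 h2; apply/forallP => i; rewrite !pos_cntE.
case/orP: (leq_total s t) => h; move: (cnt_le w i h); lia.
Qed.

Lemma near_trans x y z r s : near x y r -> near y z s -> near x z (r + s).
Proof.
move=> /forallP h1 /forallP h2; apply/forallP => i.
by move: (h1 i) (h2 i) => /= ; lia.
Qed.

Lemma near_le y p r s : r <= s -> near y p r -> near y p s.
Proof. by move=> rs /forallP h; apply/forallP => i; move: (h i) => /=; lia. Qed.

Lemma card_near p r : #|[set y | near y p r]| <= (2 * r).+1 ^ n.
Proof.
pose f (y : vertex) : {ffun 'I_n -> 'I_(2 * r).+1} := [ffun i => inord (y i + r - p i)].
have -> : (2 * r).+1 ^ n = #|{ffun 'I_n -> 'I_(2 * r).+1}| by rewrite card_ffun !card_ord.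
rewrite -(@card_in_imset _ _ f) ?max_card// => y z.
rewrite !inE => /forallP hy /forallP hz /ffunP e.
apply/ffunP => i; apply/val_inj; move: (e i) => /(congr1 (@nat_of_ord _)).
have /= hyi := hy i; have /= hzi := hz i; rewrite !ffunE !inordK; lia.
Qed.

Definition splice (a b : nat) (v u : word) : word :=
  [tuple letter (if a <= j < b then u else v) j | j < m].

Lemma letter_splice a b v u j : j < m ->
  letter (splice a b v u) j = letter (if a <= j < b then u else v) j.
Proof.
by move=> jm; rewrite {1}/letter -(tnth_nth i0 (splice a b v u) (Ordinal jm)) tnth_mktuple.
Qed.

Lemma pos_splice a b v u : a <= b <= m -> pos v a = pos u a -> pos v b = pos u b ->
  forall j, j <= m -> pos (splice a b v u) j = pos (if a <= j < b then u else v) j.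
Proof.
move=> /andP[ab bm] ea eb.
have h1 j : 0 <= j <= a -> pos (splice a b v u) j = pos v j.
  apply: pos_agree; [lia|exact: pos0|move=> k ?]; rewrite letter_splice; last lia.
  by rewrite ifF//; lia.
have h2 j : a <= j <= b -> pos (splice a b v u) j = pos u j.
  apply: pos_agree; [lia| |move=> k ?]; first by rewrite h1// leqnn.
  by rewrite letter_splice; last lia; rewrite ifT//; lia.
have h3 j : b <= j <= m -> pos (splice a b v u) j = pos v j.
  apply: pos_agree; [lia| |move=> k ?]; first by rewrite h2 ?ab ?leqnn.
  by rewrite letter_splice; last lia; rewrite ifF//; lia.
move=> j jm; case: (ltnP j a) => ja /=; first by rewrite h1//; lia.
case: (ltnP j b) => jb /=; first by rewrite h2//; lia.
by rewrite h3//; lia.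
Qed.

(** At each t in T this exchanges the steps t and t+1, so only the position at
   time t+1 changes; isolated T keeps the exchanges from overlapping. *)
Definition flip_ix (T : pred nat) (j : nat) : nat :=
  if T j then j.+1 else if (0 < j) && T j.-1 then j.-1 else j.

Definition flip (w : word) (T : pred nat) : word :=
  [tuple letter w (flip_ix T j) | j < m].

Definition isolated (T : pred nat) := forall t, T t -> (t.+1 < m) && ~~ T t.+1.

Lemma letter_flip w T j : j < m -> letter (flip w T) j = letter w (flip_ix T j).
Proof.
by move=> jm; rewrite {1}/letter -(tnth_nth i0 (flip w T) (Ordinal jm)) tnth_mktuple.
Qed.

(** The position at time t+1 once the steps t and t+1 are exchanged: the fourth
   corner of the unit square crossed by the path. *)
Definition alt (w : word) (t : nat) : vertex :=
  [ffun i => inord (cnt w t i + (letter w t.+1 == i))].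

Lemma cnt_flip w T j i : isolated T -> j <= m ->
  cnt (flip w T) j i =
  if (0 < j) && T j.-1 then cnt w j.-1 i + (letter w j == i) else cnt w j i.
Proof.
move=> iT; elim: j => [|j IH] jm; first by rewrite !cnt0.
rewrite cntS// IH ?(ltnW jm)// letter_flip// /flip_ix /=.
case Tj: (T j).
  case: andP => // -[j0 Tj1]; case/andP: (iT _ Tj1) => _.
  by rewrite prednK// Tj.
case: andP => [[j0 Tj1]|_]; last by rewrite cntS.
rewrite cntS//; have := @cntS w j.-1 i; rewrite prednK// => -> //; last exact: ltnW.
by rewrite addnAC.
Qed.

Lemma altE w t i : t.+1 < m -> alt w t i = cnt w t i + (letter w t.+1 == i) :> nat.
Proof.
move=> tm; rewrite ffunE inordK//.
have := pos_cntE (flip w (pred1 t)) t.+1 i; rewrite cnt_flip ?(ltnW tm)//=; last first.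
  by move=> s /eqP ->; rewrite tm /= gtn_eqF.
by rewrite eqxx => <-.
Qed.

Lemma pos_flip w T j : isolated T -> j <= m ->
  pos (flip w T) j = if (0 < j) && T j.-1 then alt w j.-1 else pos w j.
Proof.
move=> iT jm; apply/ffunP => i; apply/val_inj; rewrite /= pos_cntE cnt_flip//.
case: ifP => [/andP[j0 Tj]|_]; last by rewrite pos_cntE.
by case/andP: (iT _ Tj) => h _; rewrite altE// prednK.
Qed.

Lemma level_alt w t : t.+1 < m -> level (alt w t) = t.+1.
Proof.
move=> tm; have iT : isolated (pred1 t).
  by move=> s /eqP ->; rewrite tm /= gtn_eqF.
by have := level_pos (flip w (pred1 t)) (ltnW tm); rewrite pos_flip ?(ltnW tm)//= eqxx.
Qed.

Lemma near_alt w t : t.+1 < m -> near (alt w t) (pos w t) 1.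
Proof. by move=> tm; apply/forallP => i; rewrite pos_cntE altE//; case: eqP; lia. Qed.

(** The least time at which two sets of exchanges differ is visible in the words. *)
Lemma flip_inj w (S T : pred nat) : isolated S -> isolated T ->
  (forall t, S t || T t -> letter w t != letter w t.+1) ->
  flip w S = flip w T -> S =1 T.
Proof.
move=> iS iT hw e.
have key (A B : pred nat) t : isolated A -> (forall t, A t -> letter w t != letter w t.+1) ->
    isolated B -> flip w A = flip w B -> (forall s, s < t -> A s = B s) -> A t -> B t.
  move=> iA hA iB eAB h At; case/andP: (iA _ At) => tm _.
  have := congr1 (letter^~ t) eAB.
  rewrite !letter_flip ?(ltnW tm)// /flip_ix At; case: ifP => // _.
  case: ifP => [/andP[t0]|_]; last first.
    by move=> /eqP; rewrite eq_sym (negbTE (hA _ At)).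
  rewrite -h; last by rewrite prednK.
  by move=> /iA; rewrite prednK// At andbF.
move=> t; elim/ltn_ind: t => t IH.
apply/idP/idP; apply: key => //.
- by move=> s As; apply: hw; rewrite As.
- by move=> s As; apply: hw; rewrite As orbT.
- by move=> s st; rewrite IH.
Qed.

Definition lexle (v w : word) : bool := ((v : m.-tuplelexi 'I_n) <= w)%O.

Lemma lexle_total : total lexle. Proof. by move=> v w; apply: le_total. Qed.
Lemma lexle_anti v w : lexle v w -> lexle w v -> v = w.
Proof. by move=> h1 h2; apply: (@le_anti _ (m.-tuplelexi 'I_n)); apply/andP. Qed.
Lemma lexle_trans : transitive lexle.
Proof. by move=> a b c; apply: le_trans. Qed.
Lemma lexle_first v w t : t < m -> (forall j, j < t -> letter v j = letter w j) ->
  letter v t < letter w t -> lexle v w.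
Proof.
move=> tm h1 h2; apply: ltW; apply/Order.TupleLexiOrder.ltxi_tuplePlt.
exists (Ordinal tm) => [j jt|]; rewrite !(tnth_nth i0) /=; first exact: h1.
exact: h2.
Qed.

End Words.

(** * Sorting a word block by block *)

(** F factors through h. *)
Lemma leq_card_factor (A B C : finType) (F : A -> B) (h : A -> C) :
  (forall a a', h a = h a' -> F a = F a') -> #|F @: [set: A]| <= #|C|.
Proof.
move=> hF; pose K c := omap F [pick a | h a == c].
apply: (@leq_trans #|K @: [set: C]|); last by rewrite -cardsT leq_imset_card.
rewrite -(card_imset _ (@Some_inj _)); apply/subset_leq_card/fintype.subsetP => _ /imsetP[_ /imsetP[a _ ->] ->].
apply/imsetP; exists (h a); rewrite ?inE// /K.
by case: pickP => [a' /eqP /hF /= ->|/(_ a)]; rewrite ?eqxx.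
Qed.

Section BlockSort.
Variables (n m : nat) (i0 : 'I_n) (L : nat).
Hypothesis L_gt0 : 0 < L.
Notation word := (m.-tuple 'I_n).
Notation vertex := (vertex n m).
Notation M := (m %/ L).+1.
Implicit Types (v w : word).

Let geqo : rel 'I_n := fun i j => j <= i.
Let geqo_total : total geqo. Proof. by move=> i j; apply: leq_total. Qed.
Let geqo_trans : transitive geqo. Proof. by move=> i j k h1 h2; apply: leq_trans h2 h1. Qed.
Let geqo_anti : antisymmetric geqo.
Proof. by move=> i j h; apply/ord_inj/anti_leq; rewrite andbC. Qed.

(** A word is cut into blocks of L letters, the last one possibly shorter.
   Sorting each block in nonincreasing order keeps the positions at multiples
   of L and forgets all else, so few words are sorted; and a block without
   ascent is left untouched, so a path with few ascents is close to a sorted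
   one. *)
Definition segment w (b : nat) : seq 'I_n := take L (drop (b * L) w).

Fixpoint sorted_prefix w (b : nat) : seq 'I_n :=
  if b is b'.+1 then sorted_prefix w b' ++ sort geqo (segment w b') else [::].

Lemma take_block w b : take (b.+1 * L) w = take (b * L) w ++ segment w b.
Proof. by rewrite mulSn addnC takeD. Qed.

Lemma perm_sorted_prefix w b : perm_eq (sorted_prefix w b) (take (b * L) w).
Proof.
elim: b => [|b IH]; first by rewrite take0.
by rewrite take_block /=; apply: perm_cat => //; rewrite perm_sort.
Qed.

Lemma size_sorted_prefix w b : size (sorted_prefix w b) = minn (b * L) m.
Proof. by rewrite (perm_size (perm_sorted_prefix w b)) size_take_min size_tuple. Qed.

Lemma sorted_prefixD w b d :
  exists s, sorted_prefix w (b + d) = sorted_prefix w b ++ s.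
Proof.
elim: d => [|d [s e]]; first by exists [::]; rewrite addn0 cats0.
by rewrite addnS /= e; eexists; rewrite -catA.
Qed.

Lemma ltML : m < M * L. Proof. by rewrite ltn_ceil. Qed.

Definition blocksort w : word := [tuple nth i0 (sorted_prefix w M) j | j < m].

Lemma blocksortE w : blocksort w = sorted_prefix w M :> seq _.
Proof.
have sz : size (sorted_prefix w M) = m.
  by rewrite size_sorted_prefix; apply/minn_idPr/ltnW/ltML.
apply: (@eq_from_nth _ i0) => [|j]; first by rewrite size_tuple sz.
rewrite size_tuple => jm.
by rewrite -(tnth_nth i0 (blocksort w) (Ordinal jm)) tnth_mktuple.
Qed.

Lemma take_blocksort w b : b <= M -> take (b * L) (blocksort w) = sorted_prefix w b.
Proof.
move=> bM; rewrite blocksortE; have [s] := sorted_prefixD w b (M - b).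
rewrite subnKC// => e; rewrite e.
case: (leqP (b * L) m) => h.
  by rewrite take_size_cat// size_sorted_prefix; apply/minn_idPl.
have /minn_idPr sz := ltnW h.
have := size_sorted_prefix w M; have /ltnW/minn_idPr -> := ltML.
rewrite e size_cat size_sorted_prefix sz => /eqP.
rewrite -{2}[m]addn0 eqn_add2l size_eq0 => /eqP ->.
by rewrite cats0 take_oversize// size_sorted_prefix sz ltnW.
Qed.

Lemma pos_blocksort w b : b <= M -> pos (blocksort w) (b * L) = pos w (b * L).
Proof.
move=> bM; apply/eqP/pos_eqP => i; rewrite /cnt take_blocksort//.
by have /permP := perm_sorted_prefix w b.
Qed.

Definition has_ascent w (b : nat) : bool :=
  [exists q : 'I_L, (q.+1 < L) && ((b * L + q).+1 < m) &&
    (letter i0 w (b * L + q) < letter i0 w (b * L + q).+1)].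

Lemma nth_segment w b q : q < L -> b * L + q < m ->
  nth i0 (segment w b) q = letter i0 w (b * L + q).
Proof. by move=> qL h; rewrite /segment nth_take// nth_drop. Qed.

Lemma size_segment w b : size (segment w b) = minn L (m - b * L).
Proof. by rewrite /segment size_take_min size_drop size_tuple. Qed.

Lemma sorted_segment w b : ~~ has_ascent w b -> sorted geqo (segment w b).
Proof.
move=> /existsPn h; apply/(sortedP i0) => q; rewrite size_segment leq_min => /andP[h1 h2].
have qL : q < L by apply: ltnW.
have := h (Ordinal qL); rewrite /= h1 /=.
rewrite !nth_segment//; [|by lia|by lia].
rewrite negb_and => /orP[h3|]; first by lia.
by rewrite -leqNgt /geqo addnS.
Qed.

Lemma pos_blocksort_sorted w b : b < M -> ~~ has_ascent w b ->
  forall j, b * L <= j < b.+1 * L -> j <= m -> pos (blocksort w) j = pos w j.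
Proof.
move=> bM na j /andP[h1 h2] jm; apply/eqP/pos_eqP => i.
have e : take (b.+1 * L) (blocksort w) = sorted_prefix w b ++ segment w b.
  by rewrite take_blocksort//= (sorted_sort geqo_trans (sorted_segment na)).
have tk (u : word) : take j u = take j (take (b.+1 * L) u) by rewrite take_takel// ltnW.
rewrite /cnt tk e [in RHS]tk take_block !take_cat size_sorted_prefix size_take_min size_tuple.
have -> : minn (b * L) m = b * L by apply/minn_idPl; apply: leq_trans h1 jm.
rewrite ltnNge h1 /= !count_cat; congr (_ + _).
by have /permP := perm_sorted_prefix w b.
Qed.

(** Two blocks with the same endpoints have the same letters up to order. *)
Lemma eq_blocksort w w' : (forall b, b <= M -> pos w (b * L) = pos w' (b * L)) ->
  blocksort w = blocksort w'.
Proof.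
move=> e; apply/val_inj => /=; rewrite !blocksortE.
have {}e b i : b <= M -> count_mem i (take (b * L) w) = count_mem i (take (b * L) w').
  by move=> bM; have /eqP/pos_eqP := e b bM; apply.
have key b : b <= M -> sorted_prefix w b = sorted_prefix w' b; last exact: key.
elim: b => // b IH bM /=; rewrite IH; last exact: ltnW.
congr (_ ++ _); apply/perm_sortP => //.
rewrite /perm_eq; apply/allP => i _ /=; apply/eqP.
have := e b.+1 i bM; rewrite !take_block !count_cat e; last exact: ltnW.
by move/addnI.
Qed.

(** A sorted word is determined by the number of letters of each kind in each
   block: for fixed L this grows with a rate n * ln (L + 1) / L per step, which
   is small when L is large. *)
Lemma card_blocksort : #|blocksort @: [set: word]| <= (L.+1 ^ n) ^ M.
Proof.
pose h (w : word) : {ffun 'I_M -> {ffun 'I_n -> 'I_L.+1}} :=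
  [ffun b : 'I_M => [ffun i : 'I_n => inord (cnt w (b.+1 * L) i - cnt w (b * L) i)]].
have -> : (L.+1 ^ n) ^ M = #|{ffun 'I_M -> {ffun 'I_n -> 'I_L.+1}}|.
  by rewrite !card_ffun !card_ord.
apply: (@leq_card_factor _ _ _ _ h) => w w' e; apply: eq_blocksort.
elim=> [|b IH] bM; first by rewrite mul0n (pos0 w w').
have /eqP/pos_eqP eb := IH (ltnW bM); apply/eqP/pos_eqP => i.
have := congr1 (fun g : {ffun 'I_M -> {ffun 'I_n -> 'I_L.+1}} => g (Ordinal bM) i) e.
rewrite !ffunE /= => /(congr1 (@nat_of_ord _)).
have bS : b * L <= b.+1 * L by rewrite leq_mul2r leqnSn orbT.
have := cnt_le i0 w i bS; have := cnt_le i0 w' i bS.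
have -> : b.+1 * L - b * L = L by rewrite -mulnBl subSnn mul1n.
move=> /andP[h1 h2] /andP[h3 h4]; rewrite !inordK; last 2 first.
- by rewrite ltnS leq_subLR.
- by rewrite ltnS leq_subLR.
by rewrite eb in h3 h4 * => h5; rewrite -(subnKC h3) -(subnKC h1) h5.
Qed.

End BlockSort.

(** * The preferred maximal path, and how to carve a tie next to it *)

Local Open Scope ring_scope.

Section Best.
Variables (R : realDomainType) (n m : nat) (i0 : 'I_n).
Notation word := (m.-tuple 'I_n).
Notation vertex := (vertex n m).
Implicit Types (f g : vertex -> R) (v w u : word) (x y : vertex).

Definition weight f w : R := \sum_(t < m.+1) f (pos w t).

(** Ties between maximal words are broken lexicographically: the choice of the
   maximal word has to survive the creation of new ties, and a word obtained by
   exchanging an ascent is lexicographically larger. *)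
Definition outdoes f w v : bool :=
  (weight f v < weight f w) || ((weight f v == weight f w) && lexle w v).

Definition isbest f x w : bool :=
  (pos w m == x) && [forall v, (pos v m == x) ==> outdoes f w v].

Definition best f x : word := odflt (nseq_tuple m i0) [pick w | isbest f x w].

Lemma outdoes_total f : total (outdoes f).
Proof.
move=> v w; rewrite /outdoes; case: (ltgtP (weight f v) (weight f w)) => //= _.
exact: lexle_total.
Qed.

Lemma outdoes_trans f : transitive (outdoes f).
Proof.
move=> v u w /orP[h1|/andP[/eqP e1 l1]] /orP[h2|/andP[/eqP e2 l2]].
- by rewrite /outdoes (lt_trans h2 h1).
- by rewrite /outdoes e2 h1.
- by rewrite /outdoes -e1 h2.
- by rewrite /outdoes e2 e1 eqxx (lexle_trans l1 l2) orbT.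
Qed.

Lemma outdoes_refl f w : outdoes f w w.
Proof. by have := outdoes_total f w w; rewrite orbb. Qed.

Lemma isbest_uniq f x v w : isbest f x v -> isbest f x w -> v = w.
Proof.
move=> /andP[ev /forallP hv] /andP[ew /forallP hw].
move: (hv w) (hw v); rewrite ev ew /= /outdoes.
case: ltgtP => //= _; exact: lexle_anti.
Qed.

Lemma isbest_best f x w : pos w m = x -> isbest f x (best f x).
Proof.
move=> w_end; rewrite /best; case: pickP => //= h.
have [u ux hu] : exists2 u, pos u m == x & forall v, pos v m == x -> outdoes f u v.
  pose s := sort (outdoes f) (enum [pred u : word | pos u m == x]).
  have ss : sorted (outdoes f) s by apply: sort_sorted; exact: outdoes_total.
  have hs u : (u \in s) = (pos u m == x) by rewrite mem_sort mem_enum.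
  case: s ss hs => [|u s] /= ss hs.
    by have := hs w; rewrite w_end eqxx.
  exists u; first by rewrite -hs mem_head.
  move=> v; rewrite -hs inE => /orP[/eqP ->|vs]; first exact: outdoes_refl.
  by move: (order_path_min (@outdoes_trans f) ss) => /allP; apply.
have := h u; rewrite /isbest ux => /negbT /forallPn[v]; rewrite negb_imply => /andP[e].
by rewrite hu.
Qed.

Lemma best_eq f x w : isbest f x w -> best f x = w.
Proof.
move=> h; have /isbest_best : pos w m = x by case/andP: h => /eqP.
by move=> /(_ f) /isbest_uniq; apply.
Qed.

Lemma isbest_max f x w v : isbest f x w -> pos v m = x -> weight f v <= weight f w.
Proof.
move=> /andP[_ /forallP/(_ v)]; rewrite /outdoes => + e.
by rewrite e eqxx => /orP[/ltW //|/andP[/eqP -> _]].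
Qed.

Lemma eq_weight f g : f =1 g -> weight f =1 weight g.
Proof. by move=> e w; apply: eq_bigr => t _. Qed.

Lemma eq_isbest f g x : f =1 g -> isbest f x =1 isbest g x.
Proof.
move=> e w; rewrite /isbest; congr andb; apply: eq_forallb => v.
by rewrite /outdoes !(eq_weight e).
Qed.

End Best.

Section Detour.
Variables (R : realDomainType) (n m : nat) (i0 : 'I_n).
Notation word := (m.-tuple 'I_n).
Notation vertex := (vertex n m).
Variables (L : nat) (D : R).

Definition onpath (w : word) (y : vertex) : bool := [exists j : 'I_m.+1, pos w j == y].

Definition box (q : nat) (w : word) (y : vertex) : bool :=
  ((q - L <= level y)%N && (level y < q + L + L)%N) && near y (pos w q) (4 * L).

(** The window of length L starting at time p is poor when some word passing close
   to w cannot be rerouted inside the window so as to collect more than D there.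
   It depends on w only through its position at time p. *)
Definition poor_window (f : vertex -> R) (w : word) (p : nat) : bool :=
  (p + L <= m)%N &&
  [exists v : word, near (pos v p) (pos w p) (5 * L) &&
    [forall u : word, ((pos u p == pos v p) && (pos u (p + L) == pos v (p + L))) ==>
      (\sum_(p <= j < p + L) f (pos u j) <= D)]].

(** The environment in which the path w gets a tie at time t: near w and around
   the window [q, q + L[ of times, w and the alternative site are given the
   largest weight D, all other sites the smallest weight 0. *)
Definition carve (f : vertex -> R) (w : word) (q t : nat) (y : vertex) : R :=
  if box q w y then (if onpath w y || (y == alt i0 w t) then D else 0) else f y.

Variables (f : vertex -> R) (x : vertex) (w : word) (q t : nat).
Hypotheses (f_ge0 : forall y, 0 <= f y) (f_le : forall y, f y <= D) (D_gt0 : 0 < D).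
Hypotheses (wbest : isbest f x w) (qt : (q <= t)%N) (tq : (t.+1 < q + L)%N)
  (tm : (t.+1 < m)%N) (asc : (letter i0 w t < letter i0 w t.+1)%N)
  (richl : (0 < q)%N -> (L <= q)%N && ~~ poor_window f w (q - L))
  (richr : ~~ poor_window f w (q + L)).

Let f' := carve f w q t.
Let strip (j : nat) := (q - L <= j)%N && (j < q + L + L)%N.
Let gain (j : nat) : R := if strip j then D - f (pos w j) else 0.

Let w_end : pos w m = x. Proof. by case/andP: wbest => /eqP. Qed.

Let gain_ge0 j : 0 <= gain j.
Proof. by rewrite /gain; case: ifP => // _; rewrite subr_ge0. Qed.

Let onpath_pos v j : (j <= m)%N -> onpath w (pos v j) -> pos v j = pos w j.
Proof.
move=> jm /existsP[k /eqP e]; have km := ltn_ord k; rewrite ltnS in km.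
by rewrite -e -(pos_inj i0 km jm e).
Qed.

Let onpath_w j : (j <= m)%N -> onpath w (pos w j).
Proof. by move=> jm; apply/existsP; exists (Ordinal (jm : (j < m.+1)%N)). Qed.

Let box_onpath j : (j <= m)%N -> box q w (pos w j) = strip j.
Proof.
move=> jm; rewrite /box (level_pos i0)//; case: (boolP (strip j)) => [/andP[h1 h2]|]; last by rewrite /strip => /negbTE ->.
by rewrite h1 h2; apply: (near_pos i0); lia.
Qed.

Let box_strip v j : (j <= m)%N -> box q w (pos v j) -> strip j.
Proof. by move=> jm /andP[]; rewrite (level_pos i0). Qed.

Let carve_onpath j : (j <= m)%N -> f' (pos w j) = f (pos w j) + gain j.
Proof.
move=> jm; rewrite /f' /carve /gain box_onpath//; case: ifP => _; last by rewrite addr0.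
by rewrite onpath_w//= addrC subrK.
Qed.

Let weight_w : weight f' w = weight f w + \sum_(j < m.+1) gain j.
Proof. by rewrite /weight -big_split /=; apply: eq_bigr => j _; rewrite carve_onpath// -ltnS. Qed.

(** Away from the alternative site, raised weights lie on w only. *)
Let carve_offpath v j : (j <= m)%N -> pos v j != alt i0 w t -> f' (pos v j) <= f (pos v j) + gain j.
Proof.
move=> jm ne; rewrite /f' /carve (negbTE ne) orbF.
case: ifP => [hb|_]; last by rewrite lerDl gain_ge0.
case: ifP => [/(onpath_pos jm) ->|_]; last by rewrite addr_ge0 ?f_ge0 ?gain_ge0.
by rewrite /gain (box_strip jm hb) addrC subrK.
Qed.

Let pos_alt v j : (j <= m)%N -> pos v j = alt i0 w t -> j = t.+1.
Proof. by move=> jm /(congr1 (@level n m)); rewrite (level_pos i0)// level_alt. Qed.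

Let f'_le y : f' y <= D.
Proof. by rewrite /f' /carve; case: ifP => // _; case: ifP => // _; exact: ltW. Qed.

Let w_alt : pos w t.+1 != alt i0 w t.
Proof.
apply/eqP => /(congr1 (fun y : vertex => val (y (letter i0 w t)))) /=.
have tm' : (t < m)%N by exact: ltnW.
rewrite pos_cntE altE// (cntS i0 _ _ tm') eqxx => /addnI.
by have := asc; case: eqP => // ->; rewrite ltnn.
Qed.

(** A path that misses the alternative site gains at most what w gains. *)
Let avoid v : pos v m = x -> pos v t.+1 != alt i0 w t -> outdoes f' w v.
Proof.
move=> vx ne.
have h : weight f' v <= weight f v + \sum_(j < m.+1) gain j.
  rewrite /weight -big_split /=; apply: ler_sum => j _.
  have jm : (j <= m)%N by rewrite -ltnS.
  by apply: carve_offpath => //; apply: contraNneq ne => e; rewrite -(pos_alt jm e) e.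
case/andP: wbest => _ /forallP/(_ v); rewrite vx eqxx /= /outdoes weight_w.
case/orP=> [h2|/andP[/eqP h2 ->]]; first by rewrite (le_lt_trans h)// ltrD2r.
by move: h; rewrite h2 andbT [X in _ || X]eq_sym le_eqVlt eq_sym orbC.
Qed.

(** Compare v with its rerouting along u between times p and r: the weight that v
   can win at the alternative site is at most D, less than what u collects in
   the original environment, while v collects nothing there after carving. *)
Let detour v u p r : (p <= r <= m)%N -> pos v m = x ->
  pos v p = pos u p -> pos v r = pos u r ->
  D < \sum_(p <= j < r) f (pos u j) ->
  (forall j, (p <= j < r)%N -> f' (pos v j) = 0) ->
  outdoes f' w v.
Proof.
move=> pq vx ep eq hu hv; apply/orP; left.
pose v' := splice i0 p r v u.
have pv' := pos_splice i0 pq ep eq.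
have v'x : pos v' m = x by rewrite pv'// ifF// ltnNge; lia.
pose out (j : nat) := ~~ (p <= j < r)%N.
have e1 : weight f v' = \sum_(p <= j < r) f (pos u j) +
    \sum_(j < m.+1) (if out j then f (pos v j) else 0).
  rewrite /weight (bigID (fun j : 'I_m.+1 => (p <= j < r)%N)) /=; congr (_ + _).
    rewrite -(big_mkord (fun j => (p <= j < r)%N) (fun j => f (pos v' j))).
    rewrite (big_cat_nat (n := p)) /=; [|lia|lia].
    rewrite [X in _ + X](big_cat_nat (n := r)) /=; [|lia|lia].
    rewrite [X in X + _]big_nat_cond [X in X + _]big1 ?add0r; last by move=> j; lia.
    rewrite [X in _ + X]big_nat_cond [X in _ + X]big1 ?addr0; last by move=> j; lia.
    rewrite big_nat_cond [RHS]big_nat_cond; apply: eq_big => j; first lia.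
    by move=> h; rewrite /v' pv' ?ifT//; lia.
  rewrite [RHS]big_mkcond /=; rewrite [LHS]big_mkcond; apply: eq_bigr => j _.
  rewrite /out; case: ifP => // h; rewrite /v' pv' ?ifF//; last by rewrite -ltnS.
  exact: negbTE.
have e2 : weight f' v <= \sum_(j < m.+1) gain j + D +
    \sum_(j < m.+1) (if out j then f (pos v j) else 0).
  have -> : D = \sum_(j < m.+1) (if j == t.+1 :> nat then D else 0).
    have h : (t.+1 < m.+1)%N by lia.
    rewrite (bigD1 (Ordinal h))//= eqxx big1 ?addr0// => j /negbTE.
    by rewrite -val_eqE /= => ->.
  rewrite /weight -!big_split /=; apply: ler_sum => j _.
  have jm : (j <= m)%N by rewrite -ltnS.
  have := @carve_offpath v j jm; have := f'_le (pos v j); have := f_ge0 (pos v j); have := gain_ge0 j.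
  have := hv j; have := pos_alt jm (v := v); rewrite /out.
  move: (gain j) (f' (pos v j)) (f (pos v j)) => gj f'j fj.
  case: (boolP (p <= j < r)%N) => [_ _ /(_ isT) -> /=|_ + _ /=]; first by case: ifP; lra.
  case: (j =P t.+1 :> nat) => [_ _|/eqP ne h]; first lra.
  move=> h1 h2 h3 /(_ _)/wrap[]; last lra.
  by apply: contraNneq ne => /h ->.
have := isbest_max wbest v'x; rewrite weight_w e1; move: e2.
by move: (weight f' v) (\sum_(j < m.+1) gain j) => *; lra.
Qed.

Let near_v v j : pos v t.+1 = alt i0 w t -> strip j -> near (pos v j) (pos w q) (4 * L).
Proof.
move=> e /andP[h1 h2].
have n1 : near (pos v j) (pos v t.+1) (2 * L) by apply: (near_pos i0); lia.
have n2 : near (pos w t) (pos w q) (t - q) by apply: (near_pos i0); lia.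
rewrite e in n1; apply: (near_le _ (near_trans (near_trans n1 (near_alt _ _ tm)) n2)); lia.
Qed.

Let vanish v j : pos v t.+1 = alt i0 w t -> strip j -> (j <= m)%N -> j != t.+1 ->
  pos v j != pos w j -> f' (pos v j) = 0.
Proof.
move=> e sj jm jt ne; rewrite /f' /carve /box near_v// (level_pos i0)// andbT.
case: ifP => // [_|/negP//].
rewrite ifF//; apply/negbTE; rewrite negb_or; apply/andP; split.
  by apply: contraNN ne => /(onpath_pos jm) ->.
by apply: contraNneq jt => /(pos_alt jm) ->.
Qed.

Let rich_near v p : ~~ poor_window f w p -> (p + L <= m)%N ->
  near (pos v p) (pos w p) (5 * L) ->
  exists u, [/\ pos v p = pos u p, pos v (p + L) = pos u (p + L) &
    D < \sum_(p <= j < p + L) f (pos u j)].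
Proof.
move=> h am nv; move: h; rewrite /poor_window am /= => /existsPn/(_ v).
rewrite nv /= => /forallPn[u]; rewrite negb_imply -ltNge => /andP[/andP[/eqP h1 /eqP h2] h3].
by exists u.
Qed.

Let escape v p : pos v m = x -> pos v t.+1 = alt i0 w t -> ~~ poor_window f w p ->
  (p + L <= m)%N -> strip p -> (p + L <= q + L + L)%N -> (q <= p + L)%N -> (p <= q + L)%N ->
  (forall j, (p <= j < p + L)%N -> (j != t.+1) && (pos v j != pos w j)) ->
  outdoes f' w v.
Proof.
move=> vx e hp pm sp p1 p2 p3 nm.
have nv : near (pos v p) (pos w p) (5 * L).
  have n2 : near (pos w q) (pos w p) L by apply: (near_pos i0); clear -p2 p3; lia.
  by apply: (near_le _ (near_trans (near_v e sp) n2)); clear; lia.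
have [u [u1 u2 u3]] := rich_near hp pm nv.
have pr : (p <= p + L <= m)%N by rewrite leq_addr.
apply: (detour pr vx u1 u2 u3) => j hj.
have /andP[h1 h2] := nm j hj.
apply: vanish => //; last by clear -hj pm; lia.
by clear -sp hj p1; move: sp hj; rewrite /strip; lia.
Qed.

Let meet v j := strip j && (pos v j == pos w j).

(** If v does not meet w in the strip before time t+1, then there is a block
   before, for otherwise v and w would share the origin. *)
Let meet_left v : pos v m = x -> pos v t.+1 = alt i0 w t ->
  (forall j, (j < t.+1)%N -> ~~ meet v j) -> outdoes f' w v.
Proof.
move=> vx e nol.
have q0 : (0 < q)%N.
  rewrite lt0n; apply: contraT => /negPn/eqP q0; have := nol 0 isT.
  by rewrite /meet /strip q0 /= (pos0 v w) eqxx andbT; lia.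
have /andP[Lq hp] := richl q0.
apply: (@escape v (q - L)) => //; rewrite ?subnK//; [lia|rewrite /strip; lia|lia|lia|].
move=> j hj; have jt : (j < t.+1)%N by lia.
have st : strip j by rewrite /strip; lia.
by have := nol _ jt; rewrite /meet st /= => ->; lia.
Qed.

(** Symmetrically, if the window after the block were cut by the end of the
   paths, then v and w would share their endpoint. *)
Let meet_right v : pos v m = x -> pos v t.+1 = alt i0 w t ->
  (forall j, (t.+1 < j <= m)%N -> ~~ meet v j) -> outdoes f' w v.
Proof.
move=> vx e nor.
have qm : (q + L + L <= m)%N.
  rewrite leqNgt; apply/negP => h; have := nor m.
  by rewrite /meet /strip vx w_end eqxx andbT; lia.
apply: (@escape v (q + L)) => //; [rewrite /strip; lia|lia|].
move=> j hj; have jt : (t.+1 < j <= m)%N by lia.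
have st : strip j by rewrite /strip; lia.
by have := nor _ jt; rewrite /meet st /= => ->; lia.
Qed.

(** Between two meetings with w inside the strip all weights of w are D, so
   following w there is at least as good. If it is not better, then v leaves w
   just before the alternative site, by a larger letter, and is larger in the
   lexicographic order. *)
Let meet_both v a j1 : pos v m = x -> pos v t.+1 = alt i0 w t ->
  (a <= t)%N -> meet v a -> (forall j, (j < t.+1)%N -> meet v j -> (j <= a)%N) ->
  (t.+1 < j1 <= m)%N -> meet v j1 -> outdoes f' w v.
Proof.
move=> vx e at1 /andP[sa /eqP ea] amax j1m /andP[sj1 /eqP ej1].
have aj : (a <= j1 <= m)%N by clear -at1 j1m; lia.
have sab j : (a <= j < j1)%N -> strip j by clear -sa sj1; move: sa sj1; rewrite /strip; lia.
pose v2 := splice i0 a j1 v w.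
have pv2 := pos_splice i0 aj ea ej1.
have v2x : pos v2 m = x by rewrite pv2// ifF//; clear -aj; lia.
have hv2 : outdoes f' w v2.
  have h : (a <= t.+1 < j1)%N by clear -at1 j1m; lia.
  by apply: avoid => //; rewrite pv2 ?h ?w_alt// ltnW.
have term (j : 'I_m.+1) : f' (pos v j) <= f' (pos v2 j).
  have jm : (j <= m)%N by rewrite -ltnS.
  rewrite pv2//; case: ifP => // h; rewrite [X in _ <= X]carve_onpath// /gain sab// addrC subrK.
  exact: f'_le.
have le2 : weight f' v <= weight f' v2 by apply: ler_sum => j _; apply: term.
have [alt_t|ta] := ltnP a t.
  (* v is off w at time a+1, a being the last meeting, and collects 0 there *)
  apply/orP; left; apply: (@lt_le_trans _ _ (weight f' v2)); last first.
    by case/orP: hv2 => [/ltW //|/andP[/eqP -> _]].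
  have am : (a.+1 < m.+1)%N by clear -aj at1 j1m; lia.
  have aj1 : (a <= a.+1 < j1)%N by clear -at1 j1m; lia.
  rewrite /weight (bigD1 (Ordinal am))//= [ltRHS](bigD1 (Ordinal am))//=.
  apply: ltr_leD; last by apply: ler_sum => j _; apply: term.
  rewrite pv2// aj1.
  have sa1 : strip a.+1 by apply: sab.
  rewrite carve_onpath// /gain sa1 addrC subrK vanish//; first by rewrite ltn_eqF.
  apply/negP => /eqP h; have := amax a.+1; rewrite /meet sa1 h eqxx.
  by rewrite ltnS alt_t ltnn => /(_ isT isT).
have at_ : a = t by apply/eqP; rewrite eqn_leq at1.
have tm' : (t < m)%N by exact: ltnW.
have lv : letter i0 v t = letter i0 w t.+1.
  move: e => /(congr1 (fun y : vertex => val (y (letter i0 w t.+1)))) /=.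
  rewrite pos_cntE altE// (cntS i0 _ _ tm') eqxx -at_.
  have /eqP/pos_eqP -> := ea; move/addnI; by case: eqP.
have l2 : lexle v2 v.
  apply: (lexle_first (i0 := i0) tm') => [j jt|].
    rewrite letter_splice; last exact: ltn_trans jt tm'.
    by rewrite at_ leqNgt jt.
  by rewrite letter_splice// ifT ?lv// at_ leqnn; case/andP: j1m => /ltnW ->.
move: hv2; rewrite /outdoes => /orP[h|/andP[/eqP h l]]; first by rewrite (le_lt_trans le2 h).
move: le2; rewrite h le_eqVlt => /orP[/eqP -> |->//].
by rewrite eqxx (lexle_trans l l2) orbT.
Qed.

(** Carving keeps the preferred path: this is what makes it possible to recover
   the carved region from the carved environment. *)
Lemma isbest_carve : isbest f' x w.
Proof.
rewrite /isbest w_end eqxx /=; apply/forallP => v; apply/implyP => /eqP vx.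
have [e|] := eqVneq (pos v t.+1) (alt i0 w t); last exact: avoid.
have [/existsP[j0 mj0]|/existsPn nol] := boolP [exists j : 'I_t.+1, meet v j]; last first.
  by apply: meet_left => // j jt; apply: (nol (Ordinal jt)).
have [/existsP[j1 /andP[j1t mj1]]|/existsPn nor] :=
    boolP [exists j : 'I_m.+1, (t.+1 < j)%N && meet v j]; last first.
  apply: meet_right => // j /andP[tj jm].
  by have := nor (Ordinal (jm : (j < m.+1)%N)); rewrite /= tj.
have ex : exists j, (j < t.+1)%N && meet v j by exists j0; rewrite ltn_ord.
have ub j : (j < t.+1)%N && meet v j -> (j <= t)%N by case/andP.
case: (ex_maxnP ex ub) => a /andP[at1 ma] amax.
apply: (@meet_both v a j1) => //; last by rewrite j1t -ltnS ltn_ord.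
by move=> j jt mj; apply: amax; rewrite jt.
Qed.

Lemma carve_tie : f' (pos w t.+1) = D /\ f' (alt i0 w t) = D.
Proof.
have st : strip t.+1 by rewrite /strip; clear -qt tq; lia.
split; first by rewrite carve_onpath 1?ltnW// /gain st addrC subrK.
rewrite /f' /carve eqxx orbT ifT// /box level_alt//.
apply/andP; split=> //.
have n2 : near (pos w t) (pos w q) (t - q) by apply: (near_pos i0); clear -qt; lia.
by apply: (near_le _ (near_trans (near_alt _ _ tm) n2)); clear -qt tq; lia.
Qed.

End Detour.

(** * Separated ties multiply maximal paths *)

Section Ties.
Variables (R : realDomainType) (n m : nat) (i0 : 'I_n).
Notation word := (m.-tuple 'I_n).
Notation vertex := (vertex n m).
Implicit Types (f g : vertex -> R) (v w : word) (x : vertex).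

Definition maxword f x w : bool :=
  (pos w m == x) && [forall v, (pos v m == x) ==> (weight f v <= weight f w)].

Lemma isbest_maxword f x w : isbest f x w -> maxword f x w.
Proof.
move=> h; have wx := proj1 (andP h); rewrite /maxword wx /=.
by apply/forallP => v; apply/implyP => /eqP vx; apply: isbest_max h vx.
Qed.

Lemma eq_maxword f g x : f =1 g -> maxword f x =1 maxword g x.
Proof.
move=> e w; rewrite /maxword; congr andb; apply: eq_forallb => v.
by rewrite !(eq_weight e).
Qed.

Lemma flip_end w T : isolated m T -> pos (flip i0 w T) m = pos w m.
Proof.
move=> iT; rewrite pos_flip//; case: ifP => // /andP[m0 Tm].
by case/andP: (iT _ Tm); rewrite prednK// ltnn.
Qed.

Lemma weight_flip f w T : isolated m T ->
  (forall t, T t -> f (alt i0 w t) = f (pos w t.+1)) -> weight f (flip i0 w T) = weight f w.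
Proof.
move=> iT e; apply: eq_bigr => j _; rewrite pos_flip//; last by rewrite -ltnS.
by case: ifP => // /andP[j0 Tj]; rewrite e// prednK.
Qed.

(** Exchanging the steps at any subset of separated ties gives a maximal word, and
   different subsets give different words. *)
Lemma card_maxword f x w (I : finType) (s : {set I}) (tau : I -> nat) :
  maxword f x w ->
  {in s, forall b, ((tau b).+1 < m)%N && (letter i0 w (tau b) != letter i0 w (tau b).+1)} ->
  {in s, forall b, f (alt i0 w (tau b)) = f (pos w (tau b).+1)} ->
  {in s &, injective tau} -> {in s &, forall b b', tau b' != (tau b).+1} ->
  (2 ^ #|s| <= #|[set v | maxword f x v]|)%N.
Proof.
move=> /andP[/eqP wx wmax] hlt htie inj_tau hiso.
pose T (A : {set I}) (t : nat) := [exists b in A, tau b == t].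
have iT (A : {set I}) : A \subset s -> isolated m (T A).
  move=> As t /existsP[b /andP[bA /eqP <-]]; have bs := fintype.subsetP As _ bA.
  have /andP[-> _] := hlt b bs; apply/existsPn => b'; apply/negP => /andP[b'A].
  by apply/negP/hiso => //; apply: (fintype.subsetP As).
rewrite -card_powerset.
have inj : {in powerset s &, injective (fun A => flip i0 w (T A))}.
  move=> A B; rewrite !inE => As Bs /flip_inj e.
  have {}e : T A =1 T B.
    apply: e; [exact: iT|exact: iT|].
    move=> t /orP[] /existsP[b /andP[bA /eqP <-]].
      by case/andP: (hlt b (fintype.subsetP As _ bA)).
    by case/andP: (hlt b (fintype.subsetP Bs _ bA)).
  have sub (A' B' : {set I}) : A' \subset s -> B' \subset s -> T A' =1 T B' -> A' \subset B'.
    move=> A's B's e'; apply/fintype.subsetP => b bA.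
    have : T A' (tau b) by apply/existsP; exists b; rewrite bA eqxx.
    rewrite e' => /existsP[b' /andP[b'B /eqP]] /inj_tau <- //.
      exact: (fintype.subsetP B's).
    exact: (fintype.subsetP A's).
  by apply/eqP; rewrite finset.eqEsubset; apply/andP; split; apply: sub => // t; rewrite e.
rewrite -(card_in_imset inj); apply/subset_leq_card/fintype.subsetP => _ /imsetP[A + ->].
rewrite !inE => As; rewrite /maxword flip_end ?wx ?eqxx; last exact: iT.
rewrite weight_flip//; first exact: iT.
by move=> t /existsP[b /andP[bA /eqP <-]]; apply: htie; apply: (fintype.subsetP As).
Qed.

End Ties.

(** * Finite product measures *)

Section Product.
Variables (R : realFieldType) (V X : finType) (p : V -> R).
Hypotheses (p_gt0 : forall v, 0 < p v) (p_sum : \sum_v p v = 1).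
Notation config := {ffun X -> V}.
Implicit Types (om : config) (F G : config -> R).

Definition Pr om : R := \prod_y p (om y).
Definition Ex F : R := \sum_om Pr om * F om.
Definition depends (A : pred X) F :=
  forall om om', (forall y, A y -> om y = om' y) -> F om = F om'.

Lemma Pr_ge0 om : 0 <= Pr om.
Proof. by apply: prodr_ge0 => y _; apply: ltW. Qed.

Lemma sum_Pr : \sum_om Pr om = 1.
Proof.
transitivity (\prod_(y : X) \sum_v p v); last by rewrite p_sum big1_eq.
by rewrite bigA_distr_bigA.
Qed.

Lemma Ex_cst c : Ex (fun=> c) = c.
Proof. by rewrite /Ex -mulr_suml sum_Pr mul1r. Qed.

Lemma le_Ex F G : (forall om, F om <= G om) -> Ex F <= Ex G.
Proof. by move=> h; apply: ler_sum => om _; rewrite ler_wpM2l ?Pr_ge0. Qed.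

Lemma Ex_ge0 F : (forall om, 0 <= F om) -> 0 <= Ex F.
Proof. by move=> h; apply: sumr_ge0 => om _; rewrite mulr_ge0 ?Pr_ge0. Qed.

Lemma Ex_sum (I : Type) (r : seq I) (P : pred I) (F : I -> config -> R) :
  Ex (fun om => \sum_(i <- r | P i) F i om) = \sum_(i <- r | P i) Ex (F i).
Proof. by rewrite /Ex exchange_big /=; apply: eq_bigr => om _; rewrite mulr_sumr. Qed.

Lemma ExZ c F : Ex (fun om => c * F om) = c * Ex F.
Proof. by rewrite /Ex mulr_sumr; apply: eq_bigr => om _; rewrite mulrCA. Qed.

Lemma ExD F G : Ex (fun om => F om + G om) = Ex F + Ex G.
Proof. by rewrite /Ex -big_split; apply: eq_bigr => om _; rewrite mulrDr. Qed.

Lemma eq_Ex F G : F =1 G -> Ex F = Ex G.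
Proof. by move=> e; apply: eq_bigr => om _; rewrite e. Qed.

Lemma Ex_marginal (y : X) (g : V -> R) : Ex (fun om => g (om y)) = \sum_v p v * g v.
Proof.
pose h (z : X) v := p v * (if z == y then g v else 1).
transitivity (\sum_(om : config) \prod_z h z (om z)).
  apply: eq_bigr => om _; rewrite /h big_split /=; congr (_ * _).
  by rewrite (bigD1 y)//= eqxx big1 ?mulr1// => z /negbTE ->.
rewrite -bigA_distr_bigA (bigD1 y)//= [X in _ * X]big1 ?mulr1 => [|z /negbTE zy].
  by apply: eq_bigr => v _; rewrite /h eqxx.
by rewrite /h zy; under eq_bigr do rewrite mulr1.
Qed.

(** Take two independent configurations and exchange their coordinates in A: the
   law of the pair does not change, and F and G now see the same one. *)
Lemma Ex_indep (A : pred X) F G : depends A F -> depends (predC A) G ->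
  Ex (fun om => F om * G om) = Ex F * Ex G.
Proof.
move=> hF hG.
pose mix om om' : config := [ffun y => if A y then om y else om' y].
pose ex (c : config * config) := (mix c.1 c.2, mix c.2 c.1).
have exK : involutive ex.
  by case=> om om'; congr pair; apply/ffunP => y; rewrite !ffunE; case: (A y).
have PrE om om' : Pr (mix om om') * Pr (mix om' om) = Pr om * Pr om'.
  rewrite /Pr -!big_split; apply: eq_bigr => y _; rewrite !ffunE.
  by case: ifP => // _; rewrite /= mulrC.
transitivity (Ex (fun om => F om * G om) * \sum_om Pr om); first by rewrite sum_Pr mulr1.
rewrite /Ex !big_distrlr /= !pair_big /= [RHS](reindex_inj (inv_inj exK)) /=.
apply: eq_bigr => -[om om'] _ /=.
have -> : F (mix om om') = F om by apply: hF => y; rewrite ffunE => ->.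
have -> : G (mix om' om) = G om by apply: hG => y /= /negbTE h; rewrite ffunE h.
rewrite [RHS]mulrACA PrE; ring.
Qed.

Lemma Ex_prod (I : eqType) (key : X -> I) (s : seq I) (F : I -> config -> R) :
  uniq s -> (forall i, i \in s -> depends (fun y => key y == i) (F i)) ->
  Ex (fun om => \prod_(i <- s) F i om) = \prod_(i <- s) Ex (F i).
Proof.
elim: s => [_ _|i s IH /=/andP[is_ us] hF].
  by rewrite big_nil -[RHS](Ex_cst 1); apply: eq_Ex => om; rewrite big_nil.
have hFs j : j \in s -> depends (fun y => key y == j) (F j).
  by move=> js; apply: hF; rewrite inE js orbT.
rewrite big_cons -IH// -(@Ex_indep (fun y => key y == i))//; last 1 first.
- move=> om om' h; apply: eq_big_seq => j js; apply: (hFs j js) => y /eqP yj.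
  by apply: h; rewrite /= yj; apply: contraNneq is_ => <-.
- by apply: eq_Ex => om; rewrite big_cons.
- exact: hF (mem_head _ _).
Qed.

Definition pmin : R := \prod_v p v.

Lemma pmin_gt0 : 0 < pmin. Proof. exact: prodr_gt0. Qed.

Lemma p_le1 v : p v <= 1.
Proof. by rewrite -p_sum (bigD1 v)//= lerDl; apply: sumr_ge0 => u _; exact: ltW. Qed.

Lemma pmin_le v : pmin <= p v.
Proof.
rewrite /pmin (bigD1 v)//= ger_pMr//.
by apply: prodr_ile1 => u _; rewrite ltW// p_le1.
Qed.

(** Resampling on B: an upper bound on the mass of all the configurations that
   carving can send to the same one. *)
Lemma fibre_Pr (B : {set X}) om :
  \sum_(om' : config | [forall y, (y \in B) || (om' y == om y)]) Pr om' <= Pr om * pmin^-1 ^+ #|B|.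
Proof.
pose h (y : X) v : R := p v * ((y \in B) || (v == om y))%:R.
have -> : \sum_(om' : config | [forall y, (y \in B) || (om' y == om y)]) Pr om' =
    \sum_(om' : config) \prod_y h y (om' y).
  rewrite big_mkcond; apply: eq_bigr => om' _; rewrite /h big_split /=.
  case: ifPn => [/forallP hy|/forallPn[y hy]].
    by rewrite [X in _ * X]big1 ?mulr1// => y _; rewrite hy.
  by rewrite [X in _ * X](bigD1 y)//= (negbTE hy) mul0r mulr0.
have -> : pmin^-1 ^+ #|B| = \prod_y (if y \in B then pmin^-1 else 1).
  by rewrite -prodr_const big_mkcond.
rewrite -bigA_distr_bigA /Pr -big_split /=.
apply: ler_prod => y _; rewrite /h; apply/andP; split.
  by apply: sumr_ge0 => v _; rewrite mulr_ge0// ?ltW// ler0n.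
case: ifP => yB /=.
  under eq_bigr do rewrite mulr1.
  by rewrite p_sum ler_pdivlMr ?pmin_gt0// mul1r pmin_le.
rewrite mulr1 (bigD1 (om y))//= eqxx mulr1 big1 ?addr0// => v /negbTE ->.
by rewrite mulr0.
Qed.

End Product.

(** * The multi-valued map: carving the eligible blocks *)

Lemma big_opt (R : realFieldType) (T : finType) (F : option T -> R) :
  \sum_o F o = F None + \sum_t F (Some t).
Proof.
rewrite (bigD1 None)//=; congr (_ + _).
rewrite (reindex_omap Some id) => [|[t|]//=].
by apply: eq_bigl => t; rewrite eqxx.
Qed.

Section MultiValued.
Variables (R : realFieldType) (n m : nat) (i0 : 'I_n) (V : finType) (p a : V -> R).
Hypotheses (p_gt0 : forall v, 0 < p v) (p_sum : \sum_v p v = 1).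
Variables (vmin vmax : V) (D : R).
Hypotheses (a_min : a vmin = 0) (a_max : a vmax = D) (D_gt0 : 0 < D)
  (a_ge0 : forall v, 0 <= a v) (a_le : forall v, a v <= D).
Notation word := (m.-tuple 'I_n).
Notation vertex := (vertex n m).
Notation config := {ffun vertex -> V}.
Implicit Types (om : config) (w : word).
Variables (x : vertex) (L c : nat).
Hypotheses (L_gt0 : (0 < L)%N) (x_end : exists w : word, pos w m = x).

Definition values om (y : vertex) : R := a (om y).
(** The preferred path among the maximal paths to x. *)
Definition geodesic om : word := best i0 (values om) x.

Lemma isbest_geodesic om : isbest (values om) x (geodesic om).
Proof. by case: x_end => w wx; apply: isbest_best wx. Qed.

Definition ascent w (t : nat) : bool :=
  (t.+1 < m)%N && (letter i0 w t < letter i0 w t.+1)%N.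

Definition rich om w (b : nat) : bool :=
  ((0 < b)%N ==> ~~ poor_window L D (values om) w (b.-1 * L)) &&
  ~~ poor_window L D (values om) w (b.+1 * L).

(** The bound q + 1 < L keeps the two steps inside the block. *)
Definition carvable om w (b : nat) (q : 'I_L) : bool :=
  [&& (q.+1 < L)%N, ascent w (b * L + q) & rich om w b].

Definition tie om w (t : nat) : bool :=
  ascent w t && (values om (alt i0 w t) == values om (pos w t.+1)).

Notation M := (m %/ L).+1.
Notation choices := {ffun 'I_M -> option 'I_L}.
Implicit Types (g : choices).

(** Carving around block b touches the blocks b - 1, b and b + 1; restricting to one
   residue class modulo 3 makes the carved regions disjoint. The chosen ascent
   is part of the data, since the choice of a carving records its position. *)
Definition eligible om (b : 'I_M) : option 'I_L :=
  if (b %% 3 == c)%N then [pick q | carvable om (geodesic om) b q] else None.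

Definition tied om (b : 'I_M) : bool :=
  (b %% 3 == c)%N && [exists q : 'I_L, (q.+1 < L)%N && tie om (geodesic om) (b * L + q)].

Definition carve_cfg om w (q t : nat) : config :=
  [ffun y => if box L q w y then (if onpath w y || (y == alt i0 w t) then vmax else vmin)
             else om y].

Lemma values_carve om w q t : values (carve_cfg om w q t) =1 carve i0 L D (values om) w q t.
Proof.
move=> y; rewrite /values ffunE /carve; case: ifP => // _; case: ifP => // _.
Qed.

(** The function g says in which blocks to carve, and at which ascent. *)
Definition carve_all w (g : {ffun 'I_M -> option 'I_L}) (s : seq 'I_M) om : config :=
  foldr (fun b o => if g b is Some q then carve_cfg o w (b * L) (b * L + q) else o) om s.

Lemma eq_poor (f f' : vertex -> R) w r :
  (forall y, (r <= level y < r + L)%N -> f y = f' y) ->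
  poor_window L D f w r = poor_window L D f' w r.
Proof.
move=> e; rewrite /poor_window; case: (leqP (r + L) m) => //= rm.
apply: eq_existsb => v; congr andb; apply: eq_forallb => u; congr (_ ==> (_ <= _)).
rewrite big_nat_cond [RHS]big_nat_cond; apply: eq_bigr => j /andP[h _].
by apply: e; rewrite (level_pos i0)//; lia.
Qed.

Lemma eq_rich om om' w b :
  (forall y, (b.-1 * L <= level y < b.+2 * L)%N -> om y = om' y) ->
  rich om w b = rich om' w b.
Proof.
move=> e; rewrite /rich; congr (_ && ~~ _).
  case: (posnP b) => //= b0; congr negb; apply: eq_poor => y hy; rewrite /values e//.
  have : (b.-1 * L + L = b * L)%N by rewrite -[b in RHS]prednK// mulSn addnC.
  rewrite !mulSn; lia.
apply: eq_poor => y hy; rewrite /values e//.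
have : (b.-1 * L <= b * L)%N by rewrite leq_mul2r leq_pred orbT.
by move: hy; rewrite !mulSn; lia.
Qed.

Lemma box_block (b : nat) w y : box L (b * L)%N w y -> (b.-1 * L <= level y < b.+2 * L)%N.
Proof.
move=> /andP[/andP[h1 h2] _]; move: h1 h2; rewrite !mulSn -subn1 mulnBl mul1n.
by move=> h1 h2; apply/andP; split=> //; lia.
Qed.

Lemma block_disjoint (b b' : nat) (y : vertex) : (b %% 3 = b' %% 3)%N ->
  (b.-1 * L <= level y < b.+2 * L)%N -> (b'.-1 * L <= level y < b'.+2 * L)%N -> b = b'.
Proof.
move=> e /andP[h1 h2] /andP[h3 h4].
have := leq_ltn_trans h1 h4; have := leq_ltn_trans h3 h2.
by rewrite !ltn_mul2r L_gt0 /= => h5 h6; move: e; lia.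
Qed.

(** The regions are disjoint, so carving one block changes neither the richness of
   the windows around another one nor a tie created there. *)
Lemma carve_allP om w g (s : seq 'I_M) : isbest (values om) x w -> uniq s ->
  (forall (b : 'I_M) q, b \in s -> g b = Some q -> (b %% 3 == c)%N && carvable om w b q) ->
  [/\ isbest (values (carve_all w g s om)) x w,
      forall (b : 'I_M) q, b \in s -> g b = Some q -> tie (carve_all w g s om) w (b * L + q) &
      forall y, (forall b : 'I_M, b \in s -> g b -> ~~ box L (b * L)%N w y) ->
        carve_all w g s om y = om y].
Proof.
move=> hb; elim: s => [_ _|b s IH /=/andP[bs us] hg]; first by split.
have [|ib it ie] := IH us; first by move=> b' q b's; apply: hg; rewrite inE b's orbT.
case gb: (g b) => [q|]; last first.
  split=> // [b' q|y hy]; first by rewrite inE => /orP[/eqP ->|]; [rewrite gb|apply: it].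
  by apply: ie => b' b's; apply: hy; rewrite inE b's orbT.
set om1 := carve_all w g s om in ib it ie *.
have /andP[/eqP bc /and3P[qL /andP[tm asc] hr]] := hg b q (mem_head _ _) gb.
have cls b' : b' \in s -> g b' -> (b' %% 3 = c)%N.
  case gb' : (g b') => [q'|]// b's _.
  by have /andP[/eqP] := hg b' q' (mem_behead (s := b :: s) b's) gb'.
have sep b' (y : vertex) : b' \in s -> g b' -> (b'.-1 * L <= level y < b'.+2 * L)%N ->
    ~~ (b.-1 * L <= level y < b.+2 * L)%N.
  move=> b's gb' h'; apply: contraNN bs => h.
  have e : (b %% 3 = b' %% 3)%N by rewrite bc cls.
  by rewrite (ord_inj (block_disjoint e h h')).
have e1 y : (b.-1 * L <= level y < b.+2 * L)%N -> om1 y = om y.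
  move=> h; apply: ie => b' b's gb'; apply: contraL h => /box_block; exact: sep.
have {}hr : rich om1 w b by rewrite (eq_rich w e1).
have qt : (b * L <= b * L + q)%N by rewrite leq_addr.
have tq : ((b * L + q).+1 < b * L + L)%N by rewrite -addnS ltn_add2l.
have hl : (0 < b * L)%N -> (L <= b * L)%N && ~~ poor_window L D (values om1) w (b * L - L).
  rewrite muln_gt0 => /andP[b0 _]; rewrite leq_pmull//=.
  by case/andP: hr => + _; rewrite b0 /= -subn1 mulnBl mul1n.
have hr' : ~~ poor_window L D (values om1) w (b * L + L).
  by case/andP: hr => _; rewrite mulSn addnC.
have f0 y : 0 <= values om1 y by exact: a_ge0.
have f1 y : values om1 y <= D by exact: a_le.
have := isbest_carve f0 f1 D_gt0 ib qt tq tm asc hl hr'.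
rewrite -(eq_isbest x (values_carve om1 w (b * L) (b * L + q))) => ib'.
have [t1 t2] := carve_tie D_gt0 ib qt tq tm asc hl hr'.
split=> // [b' q'|y hy].
  rewrite inE => /orP[/eqP ->|b's gb'].
    rewrite gb => -[<-]; rewrite /tie /ascent tm asc /=.
    by rewrite !values_carve t1 t2 eqxx.
  have := it b' q' b's gb'; rewrite /tie => /andP[->] /=.
  have /andP[_ /and3P[q'L /andP[t'm _] _]] := hg b' q' (mem_behead (s := b :: s) b's) gb'.
  have nb y : level y = (b' * L + q').+1 -> om1 y = carve_cfg om1 w (b * L) (b * L + q) y.
    move=> ly; rewrite ffunE ifF//; apply: contraNF (sep b' y b's _ _) => [/box_block //||].
      by rewrite gb'.
    rewrite ly; have : (b'.-1 * L <= b' * L)%N by rewrite leq_mul2r leq_pred orbT.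
    by rewrite !mulSn; clear -q'L; lia.
  by rewrite /values -!nb ?(level_pos i0) ?level_alt// ltnW.
rewrite ffunE ifF; first by apply: ie => b' b's; apply: hy; rewrite inE b's orbT.
by apply/negbTE/hy; rewrite ?mem_head ?gb.
Qed.

Definition carved w (g : {ffun 'I_M -> option 'I_L}) : {set vertex} :=
  [set y | [exists b, g b && box L (b * L)%N w y]].

Definition boxsize : nat := (2 * (4 * L)).+1 ^ n.

Lemma card_carved w g : (#|carved w g| <= boxsize * #|[set b | isSome (g b)]|)%N.
Proof.
have -> : carved w g = \bigcup_(b in [set b | isSome (g b)]) [set y | box L (b * L)%N w y].
  apply/setP => y; rewrite inE; apply/existsP/bigcupP.
    by case=> b /andP[h1 h2]; exists b; rewrite inE.
  by case=> b; rewrite !inE => h1 h2; exists b; rewrite h1.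
rewrite -[X in (_ <= _ * X)%N]sum1_card big_distrr /=; elim/big_ind2: _ => [|A i B j hA hB|b _].
- by rewrite cards0.
- by apply: leq_trans (leq_card_setU _ _) (leq_add hA hB).
- rewrite muln1; apply: leq_trans (card_near (pos w (b * L)) (4 * L)).
  by apply/subset_leq_card/fintype.subsetP => y; rewrite !inE => /andP[].
Qed.

Definition ntied om : nat := #|[set b | tied om b]|.
Definition neligible om : nat := #|[set b | isSome (eligible om b)]|.

Let Q : R := (pmin p)^-1 ^+ boxsize.
(** The value for which the weights of the choices in a tied block, 1/2 for no
   carving and bonus * Q for each of the L positions, add up to 1. *)
Definition bonus : R := (2 * L%:R * Q)^-1.

Lemma Q_ge1 : 1 <= Q.
Proof.
rewrite exprn_ege1// invf_ge1 ?pmin_gt0//.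
by apply: prodr_ile1 => v _; rewrite ltW// (p_le1 p_gt0 p_sum).
Qed.

Lemma bonus_gt0 : 0 < bonus.
Proof. by rewrite invr_gt0 !mulr_gt0// ?ltr0n// (lt_le_trans ltr01 Q_ge1). Qed.

Definition carve_of om g : config := carve_all (geodesic om) g (enum 'I_M) om.

Definition admissible om g : bool := [forall b, (g b == None) || (g b == eligible om b)].

(** Blocks of the same class are far apart, so carving acts on the ties of the
   carved blocks only; the geodesic is unchanged, so the carved region is a
   function of the result and of g. *)
Lemma carve_ofP om g : admissible om g ->
  [/\ geodesic (carve_of om g) = geodesic om,
      forall b, g b -> tied (carve_of om g) b,
      forall b, g b = None -> tied (carve_of om g) b -> tied om b &
      forall y, y \notin carved (geodesic om) g -> om y = carve_of om g y].
Proof.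
move=> /forallP adm.
have hg b q : g b = Some q -> (b %% 3 == c)%N && carvable om (geodesic om) b q.
  move=> gb; have := adm b; rewrite gb /= /eligible; case: ifP => // bc /eqP.
  by case: pickP => // q' hq' [->].
have [|ib it ie] := @carve_allP om (geodesic om) g (enum 'I_M) (isbest_geodesic om) (enum_uniq _).
  by move=> b q _; apply: hg.
rewrite -/(carve_of om g) in ib it ie.
have eb : geodesic (carve_of om g) = geodesic om by apply: best_eq.
split=> // [b|b gb|y yn].
- case gb: (g b) => [q|]// _; have /andP[bc /and3P[qL _ _]] := hg b q gb.
  rewrite /tied bc; apply/existsP; exists q; rewrite qL eb.
  by apply: it => //; rewrite mem_enum.
- rewrite /tied eb => /andP[bc /existsP[q /andP[qL tq]]]; rewrite bc.
  apply/existsP; exists q; rewrite qL /=.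
  move: tq; rewrite /tie => /andP[asc]; rewrite asc /=; case/andP: asc => tm _.
  have e y : level y = (b * L + q).+1 -> carve_of om g y = om y.
    move=> ly; apply: ie => b' _ gb'; apply: contraPN gb => /box_block h'.
    have h : (b.-1 * L <= level y < b.+2 * L)%N.
      rewrite ly; have : (b.-1 * L <= b * L)%N by rewrite leq_mul2r leq_pred orbT.
      by rewrite !mulSn; clear -qL; lia.
    case gb'': (g b') gb' => [q'|]// _; have /andP[/eqP b'c _] := hg _ _ gb''.
    have e : (b %% 3 = b' %% 3)%N by rewrite b'c; apply/eqP.
    by rewrite (ord_inj (block_disjoint e h h')) gb''.
  by rewrite /values !e ?(level_pos i0) ?level_alt// ltnW.
- rewrite ie// => b _ gb; apply: contraNN yn => hb; rewrite inE.
  by apply/existsP; exists b; rewrite gb.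
Qed.

(** Weights of the choice made in block b, seen from the environment before carving
   and from the one after carving. *)
Let src_weight om (b : 'I_M) (o : option 'I_L) : R :=
  if o is Some q then (if eligible om b == Some q then bonus else 0) else 1.

Let tgt_weight om (b : 'I_M) (o : option 'I_L) : R :=
  if tied om b then (if o is Some _ then bonus else 2^-1) else (if o is Some _ then 0 else 1).

Lemma sum_src_weight om : \sum_(g : choices) \prod_b src_weight om b (g b) = (1 + bonus) ^+ neligible om.
Proof.
rewrite -bigA_distr_bigA /neligible -prodr_const [RHS]big_mkcond /=.
apply: eq_bigr => b _; rewrite big_opt /= inE.
case e: (eligible om b) => [q|] /=; last by rewrite big1 ?addr0.
by rewrite (bigD1 q)//= eqxx big1 ?addr0// => q' /negbTE h; rewrite ifF// eq_sym; apply: h.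
Qed.

Lemma src_le_tgt om g :
  2^-1 ^+ ntied om * \prod_b src_weight om b (g b) <=
  if admissible om g then \prod_b tgt_weight (carve_of om g) b (g b) else 0.
Proof.
have b0 := ltW bonus_gt0.
have w0 b o : 0 <= src_weight om b o by rewrite /src_weight; case: o => // q; case: ifP.
case: ifPn => [adm|/forallPn[b]]; last first.
  rewrite negb_or => /andP[h1 h2]; rewrite (bigD1 b)//= /src_weight.
  case gb: (g b) h1 h2 => [q|]// _; rewrite eq_sym => /negbTE ->.
  by rewrite mul0r mulr0.
have [eb h1 h2 _] := carve_ofP adm.
rewrite /ntied -prodr_const big_mkcond -big_split /=; apply: ler_prod => b _.
rewrite inE; apply/andP; split.
  by rewrite mulr_ge0//; case: ifP => //; rewrite invr_ge0 ler0n.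
rewrite /src_weight /tgt_weight; move: (h1 b) (h2 b).
case: (g b) => [q /(_ isT) -> _|_ /(_ erefl) h].
  apply: (@le_trans _ _ (1 * bonus)); last by rewrite mul1r.
  by rewrite ler_pM//; [case: ifP; lra|case: ifP|case: ifP; lra|case: ifP].
by case: (tied (carve_of om g) b) h => [/(_ isT) ->|_]; [|case: ifP]; lra.
Qed.

(** The multi-valued map. Each environment is sent to all the environments obtained
   by carving a subset of its eligible blocks. Summing the weights over these
   subsets gives the left-hand side. A given image comes from a mass at most
   Q times its own per carved block, and the carved blocks are among its tied
   blocks, so the total weight that it receives is at most its probability. *)
Lemma Ex_tied_eligible :
  Ex p (fun om => 2^-1 ^+ ntied om * (1 + bonus) ^+ neligible om) <= 1.
Proof.
have Pr0 om := Pr_ge0 p_gt0 om.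
pose H om' g : R := \prod_b tgt_weight om' b (g b).
have b0 := ltW bonus_gt0.
have H0 om' g : 0 <= H om' g.
  apply: prodr_ge0 => b _; rewrite /tgt_weight.
  by case: ifP => _; case: (g b) => [q|]; rewrite ?b0 ?invr_ge0 ?ler0n.
have Q0 : 0 < Q by apply: lt_le_trans ltr01 Q_ge1.
apply: (@le_trans _ _ (\sum_(g : choices) \sum_(om | admissible om g) Pr p om * H (carve_of om g) g)).
  rewrite /Ex; under eq_bigr do rewrite -sum_src_weight !mulr_sumr.
  rewrite exchange_big /=; apply: ler_sum => g _.
  rewrite [leRHS]big_mkcond /=; apply: ler_sum => om _.
  have := ler_wpM2l (Pr0 om) (src_le_tgt om g).
  by case: ifP => // _; rewrite mulr0.
apply: (@le_trans _ _ (\sum_(g : choices) \sum_(om' : config) H om' g * (Pr p om' * \prod_b (if g b then Q else 1)))).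
  apply: ler_sum => g _.
  rewrite (partition_big (fun om => carve_of om g) predT)//=; apply: ler_sum => om' _.
  rewrite (eq_bigr (fun om => H om' g * Pr p om)); last first.
    by move=> om /andP[_ /eqP ->]; rewrite mulrC.
  rewrite -mulr_sumr ler_wpM2l//.
  apply: (@le_trans _ _ (Pr p om' * (pmin p)^-1 ^+ #|carved (geodesic om') g|)).
    apply: le_trans (fibre_Pr p_gt0 p_sum (carved (geodesic om') g) om').
    rewrite big_mkcond [leRHS]big_mkcond; apply: ler_sum => om _.
    case: ifP => [/andP[adm /eqP e]|_]; last by case: ifP.
    have [eb _ _ h] := carve_ofP adm; rewrite ifT//; apply/forallP => y.
    case: (boolP (y \in carved (geodesic om') g)) => //= yn.
    have e2 : geodesic om = geodesic om' by rewrite -eb e.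
    by rewrite (h y) ?e2// e eqxx.
  rewrite ler_wpM2l// -big_mkcond prodr_const -exprM.
  have -> : #|[pred b | isSome (g b)]| = #|[set b | isSome (g b)]|.
    by apply: eq_card => b; rewrite !inE.
  apply: ler_weXn2l (card_carved _ _).
  rewrite invf_ge1 ?pmin_gt0//.
  by apply: prodr_ile1 => v _; rewrite ltW// (p_le1 p_gt0 p_sum).
rewrite exchange_big /= -[leRHS](sum_Pr vertex p_sum); apply: ler_sum => om' _.
have e g : H om' g * (Pr p om' * \prod_b (if g b then Q else 1)) =
    Pr p om' * \prod_b (tgt_weight om' b (g b) * (if g b then Q else 1)).
  by rewrite big_split /= mulrCA.
under eq_bigr do rewrite e.
rewrite -mulr_sumr -[leRHS]mulr1 ler_wpM2l//.
have -> : \sum_(g : choices) \prod_b (tgt_weight om' b (g b) * (if g b then Q else 1)) =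
  \prod_b \sum_o (tgt_weight om' b o * (if isSome o then Q else 1)).
  by rewrite (bigA_distr_bigA (fun b o => tgt_weight om' b o * (if isSome o then Q else 1))).
rewrite big1// => b _; rewrite big_opt /= /tgt_weight; case: ifP => _.
  rewrite sumr_const card_ord -mulr_natl /bonus mulr1.
  have L0 : L%:R != 0 :> R by rewrite pnatr_eq0 -lt0n.
  by field; rewrite L0 gt_eqF.
by rewrite big1 ?addr0 ?mulr1// => q _; rewrite mul0r.
Qed.

End MultiValued.

(** * Blocks with an ascent and eligible blocks *)

Section Blocks.
Variables (R : realFieldType) (n m : nat) (i0 : 'I_n) (L : nat) (D : R).
Hypothesis L_gt0 : (0 < L)%N.
Notation word := (m.-tuple 'I_n).
Notation vertex := (vertex n m).
Notation M := (m %/ L).+1.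
Implicit Types (f : vertex -> R) (w : word).

Definition nascent w : nat := #|[set b : 'I_M | has_ascent i0 L w b]|.
Definition npoor f w : nat := #|[set b : 'I_M | poor_window L D f w (b * L)]|.

(** The word and its sorted version visit the same sites in blocks without ascents. *)
Lemma weight_blocksort f w : (forall y, 0 <= f y) -> (forall y, f y <= D) ->
  weight f w <= weight f (blocksort i0 L w) + D * (L * nascent w)%:R.
Proof.
move=> f0 f1.
have D0 : 0 <= D := le_trans (f0 (pos w 0)) (f1 _).
have blk (t : 'I_m.+1) : (t %/ L < M)%N by rewrite ltnS leq_div2r// -ltnS.
pose B (t : 'I_m.+1) := Ordinal (blk t).
apply: (@le_trans _ _ (weight f (blocksort i0 L w) +
    \sum_(t < m.+1) (if has_ascent i0 L w (B t) then D else 0))).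
  rewrite /weight -big_split /=; apply: ler_sum => t _.
  case: ifPn => [_|na]; first by rewrite ler_wpDl.
  rewrite addr0 (pos_blocksort_sorted L_gt0 (blk t) na)//; last by rewrite -ltnS.
  by rewrite leq_trunc_div ltn_ceil.
rewrite lerD2l (partition_big B predT)//= /nascent -sum1_card big_distrr /= natr_sum mulr_sumr.
rewrite [leRHS]big_mkcond /=; apply: ler_sum => b _; rewrite inE muln1.
rewrite (eq_bigr (fun _ => if has_ascent i0 L w b then D else 0)); last first.
  by move=> t /eqP <-.
rewrite sumr_const; case: ifP => _; last by rewrite mul0rn.
rewrite -[leLHS]mulr_natr ler_wpM2l// ler_nat.
pose r (t : 'I_m.+1) : 'I_L := Ordinal (ltn_pmod t L_gt0).
rewrite -[X in (_ <= X)%N]card_ord -(@card_in_imset _ _ r) ?max_card// => s t.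
move=> hs ht [e3].
have e1 : (s %/ L = b)%N by have /eqP <- : B s == b := hs.
have e2 : (t %/ L = b)%N by have /eqP <- : B t == b := ht.
by apply/val_inj; rewrite /= (divn_eq s L) e1 -e2 e3 -divn_eq.
Qed.

Lemma eq_poor_pos f w w' r : pos w r = pos w' r ->
  poor_window L D f w r = poor_window L D f w' r.
Proof. by rewrite /poor_window => ->. Qed.

Lemma npoor_blocksort f w : npoor f (blocksort i0 L w) = npoor f w.
Proof.
apply: eq_card => b; rewrite !inE; apply: eq_poor_pos.
by rewrite pos_blocksort// ltnW.
Qed.

End Blocks.

Section Eligible.
Variables (R : realFieldType) (n m : nat) (i0 : 'I_n) (V : finType) (a : V -> R).
Variables (D : R) (x : vertex n m) (L : nat).
Hypothesis L_gt0 : (0 < L)%N.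
Notation vertex := (vertex n m).
Notation config := {ffun vertex -> V}.
Notation M := (m %/ L).+1.
Implicit Types (om : config).

(** Each poor window spoils the block before it and the block after it. *)
Lemma card_not_rich om w :
  (#|[set b : 'I_M | ~~ rich a D L om w b]| <= 2 * npoor L D (values a om) w)%N.
Proof.
set P := [set b : 'I_M | poor_window L D (values a om) w (b * L)].
have -> : npoor L D (values a om) w = #|P| by [].
pose A := [set b : 'I_M | (0 < b)%N && poor_window L D (values a om) w (b.-1 * L)].
pose B := [set b : 'I_M | poor_window L D (values a om) w (b.+1 * L)].
apply: (@leq_trans (#|A| + #|B|)).
  apply: leq_trans (leq_card_setU A B); apply/subset_leq_card/fintype.subsetP => b.
  rewrite !inE /rich negb_and negb_imply negbK => /orP[->//|]; rewrite negbK => ->.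
  by rewrite orbT.
rewrite mul2n -addnn; apply: leq_add.
  rewrite -(@card_in_imset _ _ (fun b : 'I_M => inord b.-1 : 'I_M)) => [|b b'].
    apply/subset_leq_card/fintype.subsetP => _ /imsetP[b + ->]; rewrite !inE => /andP[b0].
    by rewrite inordK// (leq_ltn_trans (leq_pred _)).
  rewrite !inE => /andP[b0 _] /andP[b'0 _] /(congr1 (@nat_of_ord _)).
  rewrite !inordK ?(leq_ltn_trans (leq_pred _))// => e.
  by apply/val_inj; rewrite /= -(prednK b0) e prednK.
have Bm (b : 'I_M) : b \in B -> (b.+1 < M)%N.
  rewrite inE /poor_window => /andP[h _]; rewrite ltnS leq_divRL//.
  exact: leq_trans (leq_addr _ _) h.
rewrite -(@card_in_imset _ _ (fun b : 'I_M => inord b.+1 : 'I_M)) => [|b b'].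
  apply/subset_leq_card/fintype.subsetP => _ /imsetP[b bB ->]; move: (bB); rewrite !inE.
  by rewrite inordK// Bm.
move=> bB b'B /(congr1 (@nat_of_ord _)); rewrite !inordK ?Bm// => -[].
exact: ord_inj.
Qed.

Lemma le_nascent om : (nascent i0 L (geodesic i0 a x om) <=
  \sum_(c < 3) neligible i0 a D x L c om + 2 * npoor L D (values a om) (geodesic i0 a x om))%N.
Proof.
set w := geodesic _ _ _ _; apply: leq_trans (leq_add (leqnn _) (card_not_rich om w)).
set N := [set b | ~~ _]; pose E := [set b : 'I_M | has_ascent i0 L w b && rich a D L om w b].
apply: (@leq_trans (#|E| + #|N|)).
  apply: leq_trans (leq_card_setU E N); apply/subset_leq_card/fintype.subsetP => b.
  by rewrite !inE => ->; rewrite orbN.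
rewrite leq_add2r -sum1_card.
under [X in (_ <= X)%N]eq_bigr do rewrite /neligible -sum1_card big_mkcond.
rewrite exchange_big /= big_mkcond; apply: leq_sum => b _.
case: ifP => //; rewrite inE => /andP[/existsP[q /andP[/andP[h1 h2] h3]] hr].
have c3 : (b %% 3 < 3)%N by rewrite ltn_mod.
rewrite (bigD1 (Ordinal c3))//= inE /eligible /= eqxx.
case: pickP => [//|/(_ q)].
by rewrite /carvable /ascent h1 h2 -/w h3 hr.
Qed.

End Eligible.

(** * Chernoff bounds for sorted words and for the geodesic *)

Lemma expR_quadratic (R : realType) (y : R) : `|y| <= 2^-1 -> expR y <= 1 + y + 2 * y ^+ 2.
Proof.
rewrite ler_norml => /andP[y1 y2]; have h := expR_ge1Dx (- y).
have hp : 0 < 1 - y by lra.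
have -> : expR y = (expR (- y))^-1 by rewrite expRN invrK.
apply: (@le_trans _ _ (1 - y)^-1); first by rewrite lef_pV2 ?posrE ?expR_gt0.
rewrite -[leLHS]mul1r ler_pdivrMr//.
have : 0 <= y ^+ 2 * (1 - 2 * y) by apply: mulr_ge0; [exact: sqr_ge0|lra].
nra.
Qed.

Section Markov.
Variables (R : realType) (V X : finType) (p : V -> R).
Hypotheses (p_gt0 : forall v, 0 < p v) (p_sum : \sum_v p v = 1).
Notation config := {ffun X -> V}.

Definition prob (E : pred config) : R := Ex p (fun om => (E om)%:R).

Lemma markov_Ex (E : pred config) (F : config -> R) :
  (forall om, 0 <= F om) -> (forall om, E om -> 1 <= F om) -> prob E <= Ex p F.
Proof.
by move=> F0 F1; apply: (le_Ex p_gt0) => om; case: (boolP (E om)) => [/F1|_].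
Qed.

Lemma le_prob (E F : pred config) : (forall om, E om -> F om) -> prob E <= prob F.
Proof.
move=> h; apply: (le_Ex p_gt0) => om; rewrite ler_nat; move: (h om).
by case: (E om) => // /(_ isT) ->.
Qed.

Lemma prob_or (E F : pred config) : prob (fun om => E om || F om) <= prob E + prob F.
Proof.
rewrite -ExD; apply: (le_Ex p_gt0) => om.
by case: (E om); case: (F om); rewrite ?addr0 ?add0r ?lerDl.
Qed.

Lemma prob_exists (I : finType) (S : {set I}) (E : I -> pred config) (q : R) :
  (forall i, i \in S -> prob (E i) <= q) ->
  prob (fun om => [exists i in S, E i om]) <= #|S|%:R * q.
Proof.
move=> h; apply: (@le_trans _ _ (\sum_(i in S) prob (E i))); last first.
  by rewrite mulr_natl -sumr_const; apply: ler_sum.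
rewrite /prob -Ex_sum; apply: (le_Ex p_gt0) => om.
case: (boolP [exists i in S, E i om]) => [/existsP[i /andP[iS Ei]]|_]; last first.
  by apply: sumr_ge0 => i _.
by rewrite (bigD1 i)//= Ei lerDl; apply: sumr_ge0.
Qed.

Lemma Ex_expR (g : config -> R) (D s : R) : (forall om, 0 <= g om <= D) ->
  `|s| * D <= 2^-1 ->
  Ex p (fun om => expR (s * g om)) <= expR (s * Ex p g + 2 * s ^+ 2 * D ^+ 2).
Proof.
move=> gD sD; apply: le_trans (expR_ge1Dx _).
apply: (@le_trans _ _ (Ex p (fun om => (1 + 2 * s ^+ 2 * D ^+ 2) + s * g om))).
  apply: (le_Ex p_gt0) => om; have /andP[g0 g1] := gD om.
  apply: le_trans (expR_quadratic _) _.
    by rewrite normrM (ger0_norm g0); apply: le_trans sD; rewrite ler_wpM2l.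
  have : s ^+ 2 * g om ^+ 2 <= s ^+ 2 * D ^+ 2.
    by rewrite ler_wpM2l ?sqr_ge0// lerXn2r// nnegrE// (le_trans g0).
  rewrite exprMn; lra.
by rewrite ExD ExZ (Ex_cst X p_sum); lra.
Qed.

End Markov.

Section Bounds.
Variables (R : realType) (n m : nat) (i0 : 'I_n) (V : finType) (p a : V -> R).
Hypotheses (p_gt0 : forall v, 0 < p v) (p_sum : \sum_v p v = 1).
Variables (vmin vmax : V) (D : R).
Hypotheses (a_min : a vmin = 0) (a_max : a vmax = D) (D_gt0 : 0 < D)
  (a_ge0 : forall v, 0 <= a v) (a_le : forall v, a v <= D).
Notation word := (m.-tuple 'I_n).
Notation vertex := (vertex n m).
Notation config := {ffun vertex -> V}.
Implicit Types (om : config) (w u : word) (h : R).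
Variables (x : vertex).

Definition mean : R := \sum_v p v * a v.
(** A lower bound for the expected gain when the better of two independent weights
   is chosen: with probability p vmin * p vmax one is 0 and the other D. *)
Definition gap : R := D * (p vmin * p vmax).

Lemma Ex_prod_ord (F : nat -> config -> R) :
  (forall t, (t <= m)%N -> depends (fun y => level y == t) (F t)) ->
  Ex p (fun om => \prod_(t < m.+1) F t om) = \prod_(t < m.+1) Ex p (F t).
Proof.
move=> hF; rewrite -(big_mkord xpredT (fun t => Ex p (F t))).
rewrite -(Ex_prod p_sum (key := @level n m)) ?iota_uniq//.
  by apply: eq_Ex => om; rewrite -(big_mkord xpredT (fun t => F t om)).
by move=> t; rewrite mem_index_iota ltnS => /hF.
Qed.

Lemma Ex_weight u h : 0 <= h -> h * D <= 2^-1 ->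
  Ex p (fun om => expR (h * weight (values a om) u)) <=
  expR (m.+1%:R * (h * mean + 2 * h ^+ 2 * D ^+ 2)).
Proof.
move=> h0 hD.
have -> : Ex p (fun om => expR (h * weight (values a om) u)) =
    Ex p (fun om => \prod_(t < m.+1) expR (h * values a om (pos u t))).
  by apply: eq_Ex => om; rewrite /weight mulr_sumr expR_sum.
rewrite (Ex_prod_ord (F := fun t om => expR (h * values a om (pos u t)))); last first.
  move=> t tm om om' e; rewrite /values e//; apply/eqP; exact: (level_pos i0).
rewrite mulr_natl -[in leRHS](card_ord m.+1) -sumr_const expR_sum.
apply: ler_prod => t _; apply/andP; split; first by apply: (Ex_ge0 p_gt0) => om; exact: expR_ge0.
have -> : mean = Ex p (fun om => values a om (pos u t)) by rewrite (Ex_marginal p_sum _ a).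
apply: (Ex_expR p_gt0 p_sum) => [om|]; first by rewrite a_ge0 a_le.
by rewrite ger0_norm.
Qed.

(** Chernoff bound for each word of S, and a union bound. *)
Lemma prob_heavy (S : {set word}) (A h : R) : 0 <= h -> h * D <= 2^-1 ->
  prob p (fun om => [exists u in S, A <= weight (values a om) u]) <=
  #|S|%:R * expR (m.+1%:R * (h * mean + 2 * h ^+ 2 * D ^+ 2) - h * A).
Proof.
move=> h0 hD; apply: (prob_exists p_gt0) => u _.
apply: (@le_trans _ _ (Ex p (fun om => expR (- (h * A)) * expR (h * weight (values a om) u)))).
  apply: (markov_Ex p_gt0) => om; first by rewrite mulr_ge0// expR_ge0.
  by move=> Au; rewrite -expRD -[leLHS]expR0 ler_expR addrC subr_ge0 ler_wpM2l.
by rewrite ExZ addrC expRD ler_wpM2l ?expR_ge0// Ex_weight.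
Qed.

Section Zigzag.
Variables (w0 : word) (k : nat).
Hypotheses (w0x : pos w0 m = x) (km : (k.*2 <= m)%N)
  (zig : forall l, (l < k)%N -> letter i0 w0 l.*2 != letter i0 w0 l.*2.+1).

Let corner (t : nat) := odd t && (t < k.*2)%N.

Let site om (t : nat) : R :=
  if corner t then Num.max (values a om (alt i0 w0 t.-1)) (values a om (pos w0 t))
  else values a om (pos w0 t).

Let even_lt t : ~~ odd t -> (t < k.*2)%N -> (t.+1 < k.*2)%N.
Proof. by clear; lia. Qed.

(** Flipping w0 at the corners where the other site is heavier realizes the sum. *)
Lemma zigzag_best om : \sum_(t < m.+1) site om t <= weight (values a om) (geodesic i0 a x om).
Proof.
pose T t := [&& ~~ odd t, (t < k.*2)%N &
  values a om (pos w0 t.+1) <= values a om (alt i0 w0 t)].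
have iT : isolated m T.
  move=> t /and3P[ev tk _]; rewrite /T /= ev /= andbT.
  by apply: leq_trans (even_lt ev tk) km.
have -> : \sum_(t < m.+1) site om t = weight (values a om) (flip i0 w0 T).
  apply: eq_bigr => t _; rewrite pos_flip//; last by rewrite -ltnS.
  rewrite /site /corner /T.
  case: t => -[|t] tm //=; case: (boolP (odd t)) => //= od.
  case: (ltnP t k.*2) => tk; last by rewrite ltnNge leqW.
  rewrite even_lt// maxC maxEle; by case: ifP.
apply: (isbest_max (isbest_geodesic i0 a (ex_intro _ w0 w0x) om)).
by rewrite flip_end.
Qed.

Lemma Ex_corner y z : y != z ->
  mean + gap <= Ex p (fun om => Num.max (values a om y) (values a om z)).
Proof.
move=> yz.
pose f v : R := (v == vmax)%:R; pose g v : R := (v == vmin)%:R.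
have -> : mean + gap = Ex p (fun om => values a om z + D * (f (om y) * g (om z))).
  rewrite ExD ExZ (Ex_marginal p_sum _ a); congr (_ + _ * _).
  rewrite (Ex_indep (A := pred1 y) (F := fun om => f (om y)) (G := fun om => g (om z)) p_sum).
  - have ind (v0 : V) : \sum_v p v * (v == v0)%:R = p v0.
      by rewrite (bigD1 v0)//= eqxx mulr1 big1 ?addr0// => v /negbTE ->; rewrite mulr0.
    by rewrite !(Ex_marginal p_sum) /f /g !ind mulrC.
  - by move=> om om' e; rewrite e//= eqxx.
  - by move=> om om' e; rewrite e//= eq_sym.
apply: (le_Ex p_gt0) => om; rewrite /f /g /values.
case: eqP => [->|_]; last by rewrite mul0r mulr0 addr0 le_max lexx orbT.
case: eqP => [->|_]; last by rewrite mulr0 mulr0 addr0 le_max lexx orbT.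
by rewrite !mulr1 a_min add0r -a_max le_max lexx.
Qed.

(** At each of its k corners the zigzag word w0 may choose the heavier of two
   sites, so the geodesic is heavier than the mean by a linear amount; Chernoff
   bound for the sum of these independent maxima. *)
Lemma prob_light (A h : R) : 0 <= h -> h * D <= 2^-1 ->
  prob p (fun om => weight (values a om) (geodesic i0 a x om) <= A) <=
  expR (h * A - m.+1%:R * (h * mean) - h * gap * k%:R + m.+1%:R * (2 * h ^+ 2 * D ^+ 2)).
Proof.
move=> h0 hD.
apply: (@le_trans _ _ (Ex p (fun om => expR (h * A) * \prod_(t < m.+1) expR (- h * site om t)))).
  apply: (markov_Ex p_gt0) => om.
    by rewrite mulr_ge0 ?expR_ge0//; apply: prodr_ge0 => t _; exact: expR_ge0.
  move=> Aw; rewrite -expR_sum -expRD -[leLHS]expR0 ler_expR -mulr_sumr mulNr subr_ge0 ler_wpM2l//.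
  exact: le_trans (zigzag_best om) Aw.
rewrite ExZ (Ex_prod_ord (F := fun t om => expR (- h * site om t))); last first.
  move=> t tm om om' e; rewrite /site /values.
  have pt : level (pos w0 t) == t by rewrite (level_pos i0).
  case: ifP => [/andP[od tk]|_]; last by rewrite e.
  have t0 : (0 < t)%N by case: t od {e tk tm pt}.
  by rewrite !e// level_alt prednK//; apply: leq_trans tk km.
pose c (t : nat) : R := (if corner t then - h * gap else 0) - h * mean + 2 * h ^+ 2 * D ^+ 2.
apply: (@le_trans _ _ (expR (h * A) * \prod_(t < m.+1) expR (c t))).
  rewrite ler_wpM2l ?expR_ge0//; apply: ler_prod => t _; apply/andP; split.
    by apply: (Ex_ge0 p_gt0) => om; exact: expR_ge0.
  have sD om : 0 <= site om t <= D.
    by rewrite /site; case: ifP => _; rewrite ?le_max ?ge_max ?a_ge0 ?a_le.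
  apply: le_trans (Ex_expR p_gt0 p_sum sD _) _; first by rewrite normrN ger0_norm.
  rewrite ler_expR /c sqrrN lerD2r; rewrite /site; case: ifP => ct; last first.
    by rewrite (Ex_marginal p_sum _ a) -/mean mulNr add0r.
  rewrite -[leRHS](_ : - h * (mean + gap) = _); last by ring.
  rewrite !mulNr lerN2 ler_wpM2l// Ex_corner//.
  case/andP: ct => od tk; have t0 : (0 < t)%N by case: (nat_of_ord t) od.
  have tk1 : (t.-1.+1 < m)%N by rewrite prednK//; apply: leq_trans tk km.
  apply/eqP => /(congr1 (fun y : vertex => nat_of_ord (y (letter i0 w0 t)))).
  have := cntS i0 w0 (letter i0 w0 t) (ltnW tk1).
  rewrite pos_cntE altE// prednK// eqxx => -> /addnI; case: eqP => // e _.
  have ev : t.-1 = t./2.*2.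
    by rewrite -{1}(odd_double_half t) od.
  have := zig (l := t./2); rewrite -ev prednK// e eqxx => /(_ _)/negP; apply => //.
  by rewrite -ltn_double; apply: leq_ltn_trans tk; rewrite -ev leq_pred.
rewrite -expR_sum -expRD ler_expR.
suff card_corner : #|[pred t : 'I_m.+1 | corner t]| = k.
  rewrite /c !big_split /= !sumr_const card_ord -big_mkcond sumr_const card_corner.
  rewrite -(mulr_natr _ k) -(mulr_natr (- (h * mean))) -(mulr_natr (2 * h ^+ 2 * D ^+ 2)); lra.
rewrite -[RHS]card_ord.
have inj : injective (fun l : 'I_k => inord l.*2.+1 : 'I_m.+1).
  have b (l : 'I_k) : (l.*2.+1 < m.+1)%N.
    by rewrite ltnS; apply: leq_trans km; rewrite ltn_double.
  by move=> l l' /(congr1 (@nat_of_ord _)); rewrite !inordK// => -[/double_inj/ord_inj].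
rewrite -(card_imset _ inj); apply: eq_card => t; rewrite !inE; apply/andP/imsetP.
  move=> [od tk]; have lk : (t./2 < k)%N by clear -od tk; lia.
  have et : (t./2).*2.+1 = t :> nat by clear -od; lia.
  by exists (Ordinal lk) => //; apply/ord_inj; rewrite /= et inordK.
case=> l _ ->; have b : (l.*2.+1 < m.+1)%N.
  by rewrite ltnS; apply: leq_trans km; rewrite ltn_double.
by rewrite /corner inordK//= odd_double ltn_Sdouble.
Qed.

End Zigzag.

End Bounds.

(** * Poor windows are rare *)

Section Poor.
Variables (R : realType) (n m : nat) (i0 : 'I_n) (V : finType) (p a : V -> R).
Hypotheses (p_gt0 : forall v, 0 < p v) (p_sum : \sum_v p v = 1).
Variables (D : R) (L : nat).
Hypothesis L_gt0 : (0 < L)%N.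
Notation word := (m.-tuple 'I_n).
Notation vertex := (vertex n m).
Notation config := {ffun vertex -> V}.
Notation M := (m %/ L).+1.
Implicit Types (om : config) (w u : word).

Definition laplace : R := \sum_v p v * expR (- a v).

Let window om u (b : nat) : R := \sum_(b * L <= j < b.+1 * L) values a om (pos u j).

Lemma Ex_window u b : (b.+1 * L <= m)%N ->
  Ex p (fun om => expR (D - window om u b)) = expR D * laplace ^+ L.
Proof.
move=> bm.
have -> : Ex p (fun om => expR (D - window om u b)) =
    Ex p (fun om => expR D * \prod_(j <- index_iota (b * L) (b.+1 * L))
      expR (- values a om (pos u j))).
  by apply: eq_Ex => om; rewrite /window -sumrN expRD expR_sum.
rewrite ExZ; congr (_ * _).
rewrite (Ex_prod p_sum (key := @level n m)
  (F := fun j om => expR (- values a om (pos u j)))) ?iota_uniq//; last first.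
  move=> j; rewrite mem_index_iota => /andP[h1 h2] om om' e; rewrite /values e//.
  by apply/eqP/(level_pos i0); lia.
under eq_bigr do rewrite (Ex_marginal p_sum _ (fun v => expR (- a v))).
rewrite big_const_nat iter_mulr_1; congr (_ ^+ _).
by rewrite -mulnBl subSnn mul1n.
Qed.

Let bridge (b : nat) (y z : vertex) : word :=
  odflt (nseq_tuple m i0) [pick u : word | (pos u (b * L) == y) && (pos u (b.+1 * L) == z)].

(** The exponential Markov bound for a poor window, summed over the possible
   endpoints of the crossing of block b; the radius 6 * L is that of the
   definition of a poor window plus the length of the block. *)
Let cost u (b : nat) om : R :=
  if (b.+1 * L <= m)%N then
    \sum_(y | near y (pos u (b * L)) (6 * L)) \sum_(z | near z (pos u (b * L)) (6 * L))
      expR (D - window om (bridge b y z) b)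
  else 0.

Lemma cost_ge0 u b om : 0 <= cost u b om.
Proof.
rewrite /cost; case: ifP => // _.
by apply: sumr_ge0 => y _; apply: sumr_ge0 => z _; exact: expR_ge0.
Qed.

Lemma cost_poor u b om : poor_window L D (values a om) u (b * L) -> 1 <= cost u b om.
Proof.
rewrite /poor_window /cost => /andP[].
have -> : (b * L + L = b.+1 * L)%N by rewrite mulSn addnC.
move=> -> /existsP[v /andP[nv /forallP hv]].
have nz : near (pos v (b.+1 * L)) (pos u (b * L)) (6 * L).
  have h : near (pos v (b.+1 * L)) (pos v (b * L)) L by apply: (near_pos i0); rewrite !mulSn; lia.
  by apply: (near_le _ (near_trans h nv)); lia.
have ny : near (pos v (b * L)) (pos u (b * L)) (6 * L) by apply: near_le nv; lia.
move: ny nz; set y := pos v (b * L); set z := pos v (b.+1 * L) => ny nz.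
have term_le (P : pred vertex) (F : vertex -> R) t :
    P t -> (forall t, 0 <= F t) -> F t <= \sum_(t | P t) F t.
  by move=> Pt F0; rewrite (bigD1 t)//= lerDl sumr_ge0.
pose G y' z' := expR (D - window om (bridge b y' z') b).
have G0 y' z' : 0 <= G y' z' by exact: expR_ge0.
apply: le_trans (term_le _ (fun y' => \sum_(z' | near z' (pos u (b * L)) (6 * L)) G y' z') y ny _);
  last by move=> y'; apply: sumr_ge0.
apply: le_trans (term_le _ (G y) z nz (G0 y)).
rewrite -[leLHS]expR0 ler_expR subr_ge0.
rewrite /bridge; case: pickP => [w /andP[e1 e2]|/(_ v)]; last by rewrite !eqxx.
by have := hv w; rewrite e1 e2.
Qed.

Definition nbridge : nat := ((2 * (6 * L)).+1 ^ n) ^ 2.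

Lemma Ex_cost u b : Ex p (cost u b) <= nbridge%:R * (expR D * laplace ^+ L).
Proof.
have lap0 : 0 <= laplace by apply: sumr_ge0 => v _; rewrite mulr_ge0 ?expR_ge0 ?ltW.
have pos0 : 0 <= expR D * laplace ^+ L by rewrite mulr_ge0 ?expR_ge0 ?exprn_ge0.
rewrite /cost; case: (leqP (b.+1 * L) m) => bm; last by rewrite (Ex_cst _ p_sum) mulr_ge0// ler0n.
rewrite Ex_sum; under eq_bigr do rewrite Ex_sum.
under eq_bigr do under eq_bigr do rewrite Ex_window//.
rewrite !sumr_const -mulrnA -[leLHS]mulr_natl ler_wpM2r// ler_nat /nbridge -mulnn.
have := card_near (pos u (b * L)) (6 * L); rewrite cardsE => h.
by apply: leq_mul.
Qed.

Lemma depends_cost u b : depends (fun y => (level y %/ L)%N == b) (cost u b).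
Proof.
move=> om om' e; rewrite /cost; case: ifP => // bm.
apply: eq_bigr => y _; apply: eq_bigr => z _; congr (expR (D - _)).
rewrite /window big_nat_cond [RHS]big_nat_cond; apply: eq_bigr => j /andP[/andP[h1 h2] _].
rewrite /values e// (level_pos i0); last by lia.
by rewrite eqn_leq leq_divRL// h1 andbT -ltnS ltn_divLR.
Qed.

(** The costs of different blocks are independent, with mean at most
   exp (- kappa); the product of the factors 1 + exp kappa * cost has mean at
   most 2 per block and is at least exp kappa to the number of poor windows. *)
Lemma prob_poor (S : {set word}) (kappa s : R) : 0 <= kappa ->
  nbridge%:R * (expR D * laplace ^+ L) <= expR (- kappa) ->
  prob p (fun om => [exists u in S, s <= (npoor L D (values a om) u)%:R]) <=
  #|S|%:R * (2 ^+ M * expR (- (kappa * s))).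
Proof.
move=> k0 hk; apply: (prob_exists p_gt0) => u _.
pose F om := expR (- (kappa * s)) * \prod_(b <- index_iota 0 M) (1 + expR kappa * cost u b om).
have c0 b om : 0 <= expR kappa * cost u b om by rewrite mulr_ge0 ?expR_ge0 ?cost_ge0.
apply: (@le_trans _ _ (Ex p F)).
  apply: (markov_Ex p_gt0) => om.
    rewrite mulr_ge0 ?expR_ge0//; apply: prodr_ge0 => b _.
    by rewrite addr_ge0.
  move=> hs; have h1 : expR (kappa * s) <= \prod_(b <- index_iota 0 M) (1 + expR kappa * cost u b om).
    apply: (@le_trans _ _ (expR kappa ^+ npoor L D (values a om) u)).
      by rewrite -expRM_natl ler_expR [leRHS]mulrC ler_wpM2l.
    rewrite big_mkord /npoor -prodr_const big_mkcond /=; apply: ler_prod => b _.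
    rewrite inE; case: ifP => [hb|_]; last by rewrite ler01 lerDl c0.
    rewrite expR_ge0 /= ler_wpDl// -[leLHS]mulr1 ler_wpM2l ?expR_ge0//.
    exact: cost_poor.
  rewrite /F -(ler_pM2l (expR_gt0 (kappa * s))) mulr1 mulrA -expRD subrr expR0 mul1r.
  exact: h1.
rewrite /F ExZ mulrC ler_wpM2r ?expR_ge0//.
rewrite (Ex_prod p_sum (key := fun y : vertex => (level y %/ L)%N)
  (F := fun b om => 1 + expR kappa * cost u b om)) ?iota_uniq//; last first.
  by move=> b _ om om' e; rewrite (@depends_cost u b om om' e).
rewrite big_mkord -[X in 2 ^+ X]card_ord -prodr_const; apply: ler_prod => b _.
rewrite (Ex_ge0 p_gt0) /=; last by move=> om; rewrite addr_ge0.
rewrite ExD (Ex_cst _ p_sum) ExZ -[leRHS]/(1 + 1) lerD2l.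
apply: (@le_trans _ _ (expR kappa * expR (- kappa))); last by rewrite -expRD subrr expR0.
by rewrite ler_wpM2l ?expR_ge0//; apply: le_trans (Ex_cost u b) hk.
Qed.

End Poor.

(** * Zigzag words and the choice of the block length *)

Section ZigzagWord.
Local Open Scope nat_scope.
Variables (n m : nat).

Lemma size_count (s : seq 'I_n) : size s = \sum_l count_mem l s.
Proof.
elim: s => [|i s IH] /=; first by rewrite big1.
rewrite big_split /= -IH (bigD1 i)//= eqxx big1 ?addn0 ?add1n// => l /negbTE.
by rewrite eq_sym => ->.
Qed.

Lemma seq_of_counts (c : 'I_n -> nat) : exists s : seq 'I_n, forall l, count_mem l s = c l.
Proof.
exists (flatten [seq nseq (c i) i | i <- enum 'I_n]) => l.
rewrite count_flatten -map_comp sumnE big_map big_enum /= (bigD1 l)//= count_nseq /= eqxx mul1n.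
by rewrite big1 ?addn0// => i /negbTE h; rewrite count_nseq /= h.
Qed.

Lemma zigzag_word (i0 i j : 'I_n) (x : vertex n m) (k : nat) :
  i != j -> k <= x i -> k <= x j -> level x = m ->
  exists w : m.-tuple 'I_n, [/\ pos w m = x, k.*2 <= m &
    forall l, l < k -> letter i0 w l.*2 != letter i0 w l.*2.+1].
Proof.
move=> ij ki kj lx.
have [s hs] := seq_of_counts (fun l => x l - k * ((i == l) + (j == l))).
pose z := mkseq (fun t => if odd t then j else i) k.*2.
have hz l : count_mem l z = k * ((i == l) + (j == l)).
  rewrite /z; elim: {ki kj hs z} k => // k IH.
  rewrite doubleS !mkseqS -!cats1 !count_cat IH /= odd_double /=; lia.
have hsz l : count_mem l (z ++ s) = x l.
  rewrite count_cat hz hs subnKC//.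
  case: (i =P l) => [<-|_] /=; first by rewrite eq_sym (negbTE ij) addn0 muln1.
  by case: (j =P l) => [<-|_] /=; rewrite ?muln1 ?muln0.
have sz : size (z ++ s) == m.
  by apply/eqP; rewrite size_count -lx; apply: eq_bigr => l _; exact: hsz.
have szz : size z = k.*2 by rewrite size_mkseq.
exists (Tuple sz); split.
- apply/ffunP => l; apply/ord_inj.
  by rewrite pos_cntE /cnt take_oversize ?size_tuple.
- by rewrite -(eqP sz) size_cat szz leq_addr.
- move=> l lk; rewrite /letter /= !nth_cat szz ltn_double lk ltn_Sdouble lk.
  by rewrite !nth_mkseq ?ltn_double ?ltn_Sdouble//= odd_double.
Qed.

End ZigzagWord.

(** The coordinates other than the largest one add up to at least beta * m. *)
Lemma two_long_axes (R : realType) (n m : nat) (x : vertex n m) (beta : R) :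
  (1 < n)%N -> level x = m -> (forall i, (x i)%:R <= (1 - beta) * m%:R) ->
  exists i j, [/\ i != j, (x j <= x i)%N & beta * m%:R <= n%:R * (x j)%:R].
Proof.
move=> n1 lx hx; pose i1 : 'I_n := Ordinal (ltnW n1).
pose i := [arg max_(i > i1) (x i : nat)].
have imax j : (x j <= x i)%N by rewrite /i; case: arg_maxnP => // k _; apply.
pose k := nat_of_ord i; have hs : beta * m%:R <= \sum_(j | j != i) (x j)%:R.
  have := hx i; have : m%:R = \sum_j (x j)%:R :> R by rewrite -natr_sum -[in LHS]lx.
  by rewrite (bigD1 i)//=; lra.
case: (pickP [pred j | (j != i) && (beta * m%:R <= n%:R * (x j)%:R)]) => [j /andP[ji hj]|h].
  by exists i, j; rewrite eq_sym.
have [j0 j0i] : exists j, j != i.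
  have [e|ne] := eqVneq i i1; last by exists i1; rewrite eq_sym.
  by exists (Ordinal n1); rewrite e.
have : \sum_(j | j != i) (x j)%:R < \sum_(j | j != i) (beta * m%:R / n%:R) :> R.
  apply: ltr_sum => [|j ji]; first by apply/hasP; exists j0; rewrite ?mem_index_enum.
  have := h j; rewrite /= ji /= => /negbT; rewrite -ltNge.
  by rewrite ltr_pdivlMr ?ltr0n 1?ltnW// mulrC.
have n0 : 0 < n%:R :> R by rewrite ltr0n ltnW.
have b0 : 0 <= beta * m%:R.
  rewrite leNgt; apply/negP => b0; have := h j0; rewrite /= j0i /= => /negbT.
  rewrite -ltNge => h1; have : 0 <= n%:R * (x j0)%:R :> R by rewrite mulr_ge0 ?ler0n.
  lra.
rewrite sumr_const -[X in _ < X]mulr_natr => h2.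
have : beta * m%:R / n%:R * #|[pred j | j != i]|%:R <= beta * m%:R.
  rewrite mulrAC ler_pdivrMr// ler_wpM2l// ler_nat -[X in (_ <= X)%N]card_ord.
  exact: max_card.
by move: hs h2; lra.
Qed.

(** Take for L a square N ^ 2, so that ln (12 * L + 1) <= 2 * ln (4 * N). *)
Lemma logarithm_small (R : realType) (alpha B C : R) : 0 < alpha -> 0 <= B -> 0 <= C ->
  exists2 L : nat, (0 < L)%N & B * ln (12 * L%:R + 1) + C <= alpha * L%:R.
Proof.
move=> a0 B0 C0; pose N := (Num.truncn ((8 * B + C) / alpha)).+1.
have N1 : 1 <= N%:R :> R by rewrite ler1n.
have hN : 8 * B + C <= alpha * N%:R.
  by rewrite [leRHS]mulrC -ler_pdivrMr// ltW// /N truncnS_gt.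
exists (N ^ 2)%N; first by rewrite expn_gt0.
have hl : ln (12 * (N ^ 2)%:R + 1) <= 8 * N%:R :> R.
  have h4 : 0 < 4 * N%:R :> R by lra.
  apply: (@le_trans _ _ (ln ((4 * N%:R) ^+ 2))).
    have l0 : 0 < 12 * (N ^ 2)%:R + 1 :> R by rewrite ltr_wpDl// mulr_ge0// ler0n.
    rewrite ler_ln ?posrE//; last by rewrite exprn_gt0.
    rewrite natrX exprMn; nra.
  by rewrite lnXn// mulr2n; have := ln_sublinear h4; lra.
apply: (@le_trans _ _ ((8 * B + C) * N%:R)); last first.
  by rewrite natrX expr2 mulrA ler_wpM2r// ler0n.
have : B * ln (12 * (N ^ 2)%:R + 1) <= B * (8 * N%:R) by rewrite ler_wpM2l.
have : C <= C * N%:R by rewrite ler_peMr.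
lra.
Qed.

(** * Many eligible blocks force many ties *)

Section Few.
Variables (R : realType) (n m : nat) (i0 : 'I_n) (V : finType) (p a : V -> R).
Hypotheses (p_gt0 : forall v, 0 < p v) (p_sum : \sum_v p v = 1).
Variables (vmin vmax : V) (D : R).
Hypotheses (a_min : a vmin = 0) (a_max : a vmax = D) (D_gt0 : 0 < D)
  (a_ge0 : forall v, 0 <= a v) (a_le : forall v, a v <= D).
Notation word := (m.-tuple 'I_n).
Notation vertex := (vertex n m).
Notation config := {ffun vertex -> V}.
Implicit Types (om : config).
Variables (x : vertex) (L : nat).
Hypotheses (L_gt0 : (0 < L)%N) (x_end : exists w : word, pos w m = x).
Notation M := (m %/ L).+1.

Definition nmax om : nat := #|[set w : word | maxword (values a om) x w]|.

(** One tie is chosen in each tied block; ties in different blocks are separated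
   because both exchanged steps belong to the block. *)
Lemma nmax_ntied (c : nat) om : (2 ^ ntied i0 a x L c om <= nmax om)%N.
Proof.
set w := geodesic i0 a x om.
pose good (b : 'I_M) (q : 'I_L) := (q.+1 < L)%N && tie i0 a om w (b * L + q).
pose q0 : 'I_L := Ordinal L_gt0.
pose tau (b : 'I_M) : nat := (b * L + odflt q0 [pick q | good b q])%N.
have tauP b : b \in [set b | tied i0 a x c om b] ->
    (tau b %/ L = b)%N /\ ((tau b).+1 %/ L = b)%N /\ tie i0 a om w (tau b).
  rewrite inE /tied -/w => /andP[_ /existsP[q hq]]; rewrite /tau.
  case: pickP => [q' /andP[qL tq] /=|/(_ q)]; last by rewrite /good hq.
  split; first by rewrite divnMDl// (divn_small (ltn_ord q')) addn0.
  by split=> //; rewrite -addnS divnMDl// (divn_small qL) addn0.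
apply: (card_maxword (i0 := i0) (w := w) (tau := tau)).
- exact: isbest_maxword (isbest_geodesic i0 a x_end om).
- move=> b /tauP[_ [_ /andP[/andP[-> asc] _]]] /=.
  by apply: contraTneq asc => ->; rewrite ltnn.
- by move=> b /tauP[_ [_ /andP[_ /eqP]]].
- move=> b b' /tauP[e _] /tauP[e' _] h; apply: ord_inj.
  by rewrite -e -e' h.
- move=> b b' /tauP[e [e1 _]] /tauP[e' _]; apply/eqP => h.
  have bb : b = b' by apply: ord_inj; rewrite -e' h e1.
  by move: h; rewrite bb => /eqP; rewrite ltn_eqF.
Qed.

Lemma prob_few_ties (c : nat) (s T : R) : 0 <= T ->
  prob p (fun om => (s <= (neligible i0 a D x L c om)%:R) && ((nmax om)%:R <= T)) <=
  T * expR (- (s * ln (1 + bonus n p L))).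
Proof.
move=> T0; set lam := 1 + bonus n p L.
have b0 := bonus_gt0 n p_gt0 p_sum L_gt0.
have lam1 : 1 < lam by rewrite ltrDl.
have lam0 : 0 < lam by exact: lt_trans lam1.
have l0 : 0 <= ln lam by rewrite ln_ge0// ltW.
set K := T * _; have K0 : 0 <= K by rewrite mulr_ge0// expR_ge0.
pose F om : R := 2^-1 ^+ ntied i0 a x L c om * lam ^+ neligible i0 a D x L c om.
have F0 om : 0 <= F om.
  by rewrite mulr_ge0 ?exprn_ge0// ?invr_ge0 ?ler0n// ltW.
apply: (@le_trans _ _ (Ex p (fun om => K * F om))); last first.
  rewrite ExZ -[leRHS]mulr1 ler_wpM2l//.
  exact: (Ex_tied_eligible i0 p_gt0 p_sum a_min a_max D_gt0 a_ge0 a_le c L_gt0 x_end).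
apply: (markov_Ex p_gt0) => om; first by rewrite mulr_ge0.
move=> /andP[hs hT].
have h1 : 1 <= T * 2^-1 ^+ ntied i0 a x L c om.
  rewrite exprVn ler_pdivlMr ?exprn_gt0// mul1r; apply: le_trans hT.
  by rewrite -natrX ler_nat nmax_ntied.
have h2 : 1 <= expR (- (s * ln lam)) * lam ^+ neligible i0 a D x L c om.
  rewrite -[X in _ * X ^+ _](lnK lam0) -expRM_natl -expRD -[leLHS]expR0 ler_expR.
  by rewrite addrC subr_ge0 ler_wpM2r.
by rewrite /K /F mulrACA -[leLHS]mulr1 ler_pM.
Qed.

Variables (w0 : word) (k : nat).
Hypotheses (w0x : pos w0 m = x) (km : (k.*2 <= m)%N)
  (zig : forall l, (l < k)%N -> letter i0 w0 l.*2 != letter i0 w0 l.*2.+1).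

Let Sg := blocksort i0 L @: [set: word].

(** A geodesic heavier than every sorted word has many blocks with an ascent, by
   comparison with its own sorted version. Poor windows spoil at most 2 * s of
   them, and one of the three residue classes has a third of the others. *)
Lemma many_eligible om (E s g : R) :
  E + g < weight (values a om) (geodesic i0 a x om) ->
  (forall u, u \in Sg -> weight (values a om) u < E) ->
  (forall u, u \in Sg -> (npoor L D (values a om) u)%:R < s) ->
  exists c : 'I_3, g / (D * L%:R) - 2 * s <= 3 * (neligible i0 a D x L c om)%:R.
Proof.
set w := geodesic _ _ _ _ => hw hE hs.
have wS : blocksort i0 L w \in Sg by apply: imset_f; rewrite inE.
have f0 y : 0 <= values a om y by exact: a_ge0.
have f1 y : values a om y <= D by exact: a_le.
have h1 := weight_blocksort i0 L_gt0 w f0 f1.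
have h2 := hE _ wS; have h3 := hs _ wS.
have DL : 0 < D * L%:R by rewrite mulr_gt0 ?ltr0n.
have h4 : g / (D * L%:R) <= (nascent i0 L w)%:R.
  rewrite ler_pdivrMr//; move: h1; rewrite natrM; lra.
have h5 : (nascent i0 L w)%:R <= (\sum_(c < 3) neligible i0 a D x L c om)%:R +
    2 * (npoor L D (values a om) w)%:R :> R.
  by rewrite -natrM -natrD ler_nat; exact: le_nascent.
rewrite (npoor_blocksort i0) in h3 => //.
apply/existsP; apply: contraT => /existsPn h.
have : \sum_(c < 3) (neligible i0 a D x L c om)%:R < \sum_(c < 3) ((g / (D * L%:R) - 2 * s) / 3) :> R.
  apply: ltr_sum => [|c _]; first by apply/hasP; exists ord0; rewrite ?mem_index_enum.
  by have := h c; rewrite -ltNge ltr_pdivlMr// mulrC.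
rewrite sumr_const card_ord -mulr_natr natr_sum in h5 *; lra.
Qed.

End Few.

(** * Choice of the constants *)

Section Normalized.
Variables (R : realType) (n : nat) (i0 : 'I_n) (V : finType) (p a : V -> R).
Hypotheses (p_gt0 : forall v, 0 < p v) (p_sum : \sum_v p v = 1).
Variables (vmin vmax : V) (D : R).
Hypotheses (a_min : a vmin = 0) (a_max : a vmax = D) (D_gt0 : 0 < D)
  (a_ge0 : forall v, 0 <= a v) (a_le : forall v, a v <= D).
Variable (kappa : R).
Hypotheses (kappa_gt0 : 0 < kappa) (kappa_le1 : kappa <= 1).

Lemma laplace_gt0 : 0 < laplace p a.
Proof.
rewrite /laplace (bigD1 vmin)//= ltr_pwDl ?mulr_gt0 ?expR_gt0//.
by apply: sumr_ge0 => v _; rewrite mulr_ge0 ?expR_ge0// ltW.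
Qed.

Lemma laplace_lt1 : laplace p a < 1.
Proof.
rewrite -p_sum /laplace (bigD1 vmax)//= [ltRHS](bigD1 vmax)//=; apply: ltr_leD.
  by rewrite gtr_pMr// a_max -[ltRHS]expR0 ltr_expR oppr_lt0.
by apply: ler_sum => v _; rewrite ger_pMr// -[leRHS]expR0 ler_expR oppr_le0.
Qed.

Notation g := (gap p vmin vmax D).
(** The constants. The exponent of the Chernoff bounds is tilt; it is so small that
   their second-order terms, at most rate * m, are at most an eighth of the first
   order gain tilt * gap * k of the geodesic over the mean. The rate in L at which
   poor windows become rare is decay, and sparsity * m / L is the number of poor
   windows that the ascents can afford. *)
Definition tilt : R := g * kappa / (32 * D ^+ 2).
Definition rate : R := tilt * g * kappa / 8.
Definition sparsity : R := g * kappa / (16 * D).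
Definition decay : R := - ln (laplace p a).

Let gap_gt0 : 0 < g. Proof. by rewrite !mulr_gt0. Qed.
Let gap_le : g <= D.
Proof.
rewrite -[leRHS]mulr1; apply: ler_wpM2l; first exact: ltW.
by apply: mulr_ile1; [exact: ltW|exact: ltW|exact: p_le1|exact: p_le1].
Qed.
Let tilt_gt0 : 0 < tilt. Proof. by rewrite divr_gt0 ?mulr_gt0 ?exprn_gt0. Qed.
Let tilt_le : tilt * D <= 2^-1.
Proof.
have -> : tilt * D = (g * kappa) / (32 * D).
  by rewrite /tilt; field; rewrite gt_eqF.
rewrite ler_pdivrMr ?mulr_gt0//.
have : g * kappa <= D * 1 by apply: ler_pM => //; exact: ltW.
have := D_gt0; lra.
Qed.
Let rate_gt0 : 0 < rate. Proof. by rewrite divr_gt0// (mulr_gt0 (mulr_gt0 tilt_gt0 gap_gt0)). Qed.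
Let rateE : 4 * tilt ^+ 2 * D ^+ 2 = rate.
Proof. by rewrite /rate {2}/tilt /tilt; field; rewrite gt_eqF. Qed.
Let sparsity_gt0 : 0 < sparsity. Proof. by rewrite divr_gt0 ?mulr_gt0. Qed.
Let decay_gt0 : 0 < decay.
Proof. by rewrite oppr_gt0 ln_lt0// laplace_gt0 laplace_lt1. Qed.

Section BlockLength.
Variable (L : nat).
Notation l := (L%:R : R).
Definition loglen : R := ln (12 * l + 1).
Hypotheses (L_gt0 : (0 < L)%N) (L_heavy : 2 * n%:R * loglen <= rate / 2 * l)
  (L_poor : 2 * n%:R * loglen + 2 * ln 2 + 1 <= sparsity * (l * decay - 2 * n%:R * loglen - D)).

Let l_ge1 : 1 <= l. Proof. by rewrite ler1n. Qed.
Let loglen_ge : ln (l + 1) <= loglen.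
Proof. by have l1 := l_ge1; rewrite ler_ln ?posrE; lra. Qed.
Let lnL_ge0 : 0 <= ln (l + 1). Proof. by have l1 := l_ge1; rewrite ln_ge0//; lra. Qed.
Let ln2_ge0 : 0 <= ln 2 :> R. Proof. by rewrite ln_ge0//; lra. Qed.
Let n_ge0 : 0 <= n%:R :> R. Proof. exact: ler0n. Qed.

(** Outside the exceptional events, at least density * m blocks of some residue
   class are eligible; logbonus is what each of them contributes to the
   exponent. *)
Definition density : R := g * kappa / (24 * D * l).
Definition logbonus : R := ln (1 + bonus n p L).
Let density_gt0 : 0 < density.
Proof. by have := l_ge1 => l1; rewrite divr_gt0 ?mulr_gt0//; lra. Qed.
Let logbonus_gt0 : 0 < logbonus.
Proof. by rewrite ln_gt0// ltrDl (bonus_gt0 n p_gt0 p_sum L_gt0). Qed.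

Definition exponent : R := Num.min (Num.min (rate / 2) l^-1) (density * logbonus).
Lemma exponent_gt0 : 0 < exponent.
Proof. by rewrite !lt_min divr_gt0//= invr_gt0 (lt_le_trans ltr01 l_ge1) mulr_gt0. Qed.

Section Size.
Variables (m : nat) (x : vertex n m) (w0 : m.-tuple 'I_n) (k : nat).
Hypotheses (w0x : pos w0 m = x) (km : (k.*2 <= m)%N)
  (zig : forall j, (j < k)%N -> letter i0 w0 j.*2 != letter i0 w0 j.*2.+1)
  (k_ge : kappa * m%:R <= k%:R) (Lm : (L <= m)%N).
Notation config := {ffun vertex n m -> V}.
Notation M := (m %/ L).+1.
Let S := blocksort i0 L @: [set: m.-tuple 'I_n].
Definition nblocks : R := m%:R / l.

Let m_ge1 : 1 <= m%:R :> R. Proof. by rewrite ler1n (leq_trans L_gt0). Qed.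
Let nblocksE : nblocks * l = m%:R.
Proof. by have l1 := l_ge1; rewrite /nblocks divfK// gt_eqF//; lra. Qed.
Let nblocks_ge0 : 0 <= nblocks. Proof. by rewrite divr_ge0// ler0n. Qed.

Let M_le : M%:R <= 2 * nblocks.
Proof.
have l1 := l_ge1; have : 1 <= nblocks by rewrite ler_pdivlMr ?mul1r ?ler_nat//; lra.
have : (m %/ L)%:R <= nblocks.
  by rewrite ler_pdivlMr -?natrM ?ler_nat ?leq_trunc_div//; lra.
by rewrite -natr1; lra.
Qed.

Let card_S : #|S|%:R <= expR (2 * n%:R * ln (l + 1) * nblocks).
Proof.
apply: (@le_trans _ _ (((L.+1 ^ n) ^ M)%N)%:R).
  by rewrite ler_nat; exact: card_blocksort.
have L1 : L.+1%:R = l + 1 :> R by rewrite -natr1.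
have l1 := l_ge1; have L1p : 0 < l + 1 by lra.
rewrite !natrX L1 -exprM -[X in X ^+ _](lnK L1p) -expRM_natl ler_expR natrM.
have : n%:R * ln (l + 1) * M%:R <= n%:R * ln (l + 1) * (2 * nblocks).
  by rewrite ler_wpM2l// mulr_ge0.
lra.
Qed.

Let gap_corners : g * kappa * m%:R <= g * k%:R.
Proof. by rewrite -mulrA ler_wpM2l// ltW. Qed.

Let noise : m.+1%:R * (2 * tilt ^+ 2 * D ^+ 2) <= rate * m%:R.
Proof.
have e : 2 * tilt ^+ 2 * D ^+ 2 = rate / 2 by rewrite -rateE; field.
rewrite e -natr1; have := rate_gt0; have := m_ge1; nra.
Qed.

Let rate_corners : 8 * (rate * m%:R) <= tilt * (g * k%:R).
Proof.
have -> : 8 * (rate * m%:R) = tilt * (g * kappa * m%:R) by rewrite /rate; field.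
by rewrite ler_wpM2l// ltW.
Qed.

(** A level between the weights of the sorted words and that of the geodesic. *)
Definition baseline : R := m.+1%:R * mean p a + g * k%:R / 4.

Let light : prob p (fun om : config => weight (values a om) (geodesic i0 a x om) <= baseline + g * k%:R / 4)
  <= expR (- (rate * m%:R)).
Proof.
apply: le_trans (prob_light p_gt0 p_sum a_min a_max a_ge0 a_le w0x km zig _ (ltW tilt_gt0) tilt_le) _.
rewrite ler_expR /baseline; have := noise; have := rate_corners; have := ltW rate_gt0; have := m_ge1.
move: (m.+1%:R : R) (m%:R : R) => m1 mm *; nra.
Qed.

Let heavy : prob p (fun om : config => [exists u in S, baseline <= weight (values a om) u])
  <= expR (- (rate / 2 * m%:R)).
Proof.
apply: le_trans (prob_heavy i0 p_gt0 p_sum a_ge0 a_le S baseline (ltW tilt_gt0) tilt_le) _.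
apply: le_trans (ler_wpM2r (expR_ge0 _) card_S) _.
rewrite -expRD ler_expR /baseline; have := noise; have := rate_corners.
have : 2 * n%:R * ln (l + 1) * nblocks <= rate / 2 * m%:R.
  have -> : rate / 2 * m%:R = rate / 2 * l * nblocks by rewrite -nblocksE; ring.
  by rewrite ler_wpM2r//; apply: le_trans L_heavy; rewrite ler_wpM2l// mulr_ge0.
move: (m.+1%:R : R) (m%:R : R) => m1 mm *; lra.
Qed.

Let poor : prob p (fun om : config => [exists u in S, sparsity * nblocks <= (npoor L D (values a om) u)%:R])
  <= expR (- nblocks).
Proof.
pose K : R := l * decay - 2 * n%:R * loglen - D.
have tK : 1 <= sparsity * K.
  apply: le_trans L_poor; rewrite -[leLHS]add0r lerD2r addr_ge0 ?mulr_ge0//.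
  by apply: le_trans loglen_ge.
have K0 : 0 <= K by rewrite -(pmulr_rge0 _ sparsity_gt0) (le_trans ler01).
have nb : (nbridge n L)%:R * (expR D * laplace p a ^+ L) <= expR (- K).
  have e1 : (nbridge n L)%:R = expR (2 * n%:R * loglen) :> R.
    have lp : 0 < 12 * l + 1 by have := l_ge1; lra.
    have -> : (nbridge n L)%:R = (12 * l + 1) ^+ (n * 2).
      rewrite /nbridge -expnM natrX; congr (_ ^+ _).
      by rewrite -natr1 !natrM /l; ring.
    rewrite -[X in X ^+ _](lnK lp) -expRM_natl natrM /loglen; congr expR; ring.
  have e2 : laplace p a ^+ L = expR (- (l * decay)).
    by rewrite -[X in X ^+ _](lnK laplace_gt0) -expRM_natl /decay; congr expR; ring.
  by rewrite e1 e2 -!expRD ler_expR /K; lra.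
apply: le_trans (prob_poor i0 p_gt0 p_sum L_gt0 S (sparsity * nblocks) K0 nb) _.
apply: le_trans (ler_wpM2r _ card_S) _; first by rewrite mulr_ge0 ?expR_ge0 ?exprn_ge0.
have e3 : 2 ^+ M = expR (M%:R * ln 2) :> R by rewrite expRM_natl lnK// posrE.
rewrite e3 -!expRD ler_expR.
have h1 : M%:R * ln 2 <= 2 * nblocks * ln 2 by rewrite ler_wpM2r.
have h2 : 2 * n%:R * ln (l + 1) * nblocks <= 2 * n%:R * loglen * nblocks.
  by rewrite ler_wpM2r// ler_wpM2l// mulr_ge0.
have h3 : (2 * n%:R * loglen + 2 * ln 2 + 1) * nblocks <= sparsity * K * nblocks by rewrite ler_wpM2r.
lra.
Qed.

Definition delta : R := exponent / 4.

Let few_ties (c : nat) :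
  prob p (fun om : config => (density * m%:R <= (neligible i0 a D x L c om)%:R) &&
    ((nmax a x om)%:R <= 2 `^ (delta * m%:R))) <= expR (- (3 * delta * m%:R)).
Proof.
have xe : exists w : m.-tuple 'I_n, pos w m = x by exists w0.
apply: le_trans (prob_few_ties i0 p_gt0 p_sum a_min a_max D_gt0 a_ge0 a_le L_gt0 xe c _ (powR_ge0 _ _)) _.
rewrite /powR ifF; last by apply/negbTE; rewrite pnatr_eq0.
rewrite -expRD ler_expR -/logbonus.
have ln2 : ln 2 <= 1 :> R.
  by have := @le_ln1Dx R 1; rewrite -natr1 => ->//; lra.
have c1le : exponent <= density * logbonus by rewrite /exponent ge_min lexx orbT.
have d0 : 0 <= delta * m%:R by rewrite mulr_ge0 ?ler0n// divr_ge0// ltW// exponent_gt0.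
have h1 : delta * m%:R * ln 2 <= delta * m%:R * 1 by rewrite ler_wpM2l.
have h2 : exponent * m%:R <= density * logbonus * m%:R by rewrite ler_wpM2r// ler0n.
rewrite /delta in h1 *; lra.
Qed.

(** The event is covered by a light geodesic, a heavy sorted word, many poor windows,
   and, for the three residue classes, few ties in spite of many eligible
   blocks; the condition on m absorbs the number 6 of terms. *)
Lemma prob_few : 10 <= exponent * m%:R ->
  prob p (fun om : config => (nmax a x om)%:R <= 2 `^ (delta * m%:R)) <= expR (- (delta * m%:R)).
Proof.
move=> c10.
have xe : exists w : m.-tuple 'I_n, pos w m = x by exists w0.
pose E1 (om : config) := weight (values a om) (geodesic i0 a x om) <= baseline + g * k%:R / 4.
pose E2 (om : config) := [exists u in S, baseline <= weight (values a om) u].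
pose E3 (om : config) := [exists u in S, sparsity * nblocks <= (npoor L D (values a om) u)%:R].
pose E4 (om : config) := [exists c in [set: 'I_3], (density * m%:R <= (neligible i0 a D x L c om)%:R) &&
    ((nmax a x om)%:R <= 2 `^ (delta * m%:R))].
have sub om : (nmax a x om)%:R <= 2 `^ (delta * m%:R) -> E1 om || (E2 om || (E3 om || E4 om)).
  move=> hf; case: (boolP (E1 om)) => //=; rewrite /E1 -ltNge => h1.
  case: (boolP (E2 om)) => //= /existsPn h2; case: (boolP (E3 om)) => //= /existsPn h3.
  have h2' u : u \in S -> weight (values a om) u < baseline.
    by move=> uS; have := h2 u; rewrite uS -ltNge.
  have h3' u : u \in S -> (npoor L D (values a om) u)%:R < sparsity * nblocks.
    by move=> uS; have := h3 u; rewrite uS -ltNge.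
  have [c hc] := many_eligible D_gt0 a_ge0 a_le L_gt0 h1 h2' h3'.
  apply/existsP; exists c; rewrite inE hf andbT /=.
  have lp : 0 < l by have := l_ge1; lra.
  have Dl : 0 < D * l by rewrite mulr_gt0.
  have h4 : g * kappa * m%:R / (4 * D * l) <= g * k%:R / 4 / (D * l).
    have -> : g * k%:R / 4 / (D * l) = g * k%:R / (4 * D * l) by field; rewrite !gt_eqF.
    by rewrite ler_wpM2r// invr_ge0 -mulrA mulr_ge0// ltW.
  have e : g * kappa * m%:R / (4 * D * l) - 2 * (sparsity * nblocks) = 3 * (density * m%:R).
    by rewrite /sparsity /nblocks /density; field; rewrite !gt_eqF.
  by move: hc; lra.
apply: le_trans (le_prob p_gt0 (F := fun om => E1 om || (E2 om || (E3 om || E4 om))) sub) _.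
have t4 : prob p E4 <= 3 * expR (- (3 * delta * m%:R)).
  have := prob_exists p_gt0 (S := [set: 'I_3]) (fun c _ => few_ties c).
  by rewrite cardsT card_ord.
have b1 : expR (- (rate / 2 * m%:R)) <= expR (- (3 * delta * m%:R)).
  rewrite ler_expR lerN2 ler_wpM2r ?ler0n//.
  have : exponent <= rate / 2 by rewrite /exponent !ge_min lexx.
  by rewrite /delta; have := exponent_gt0; lra.
have b0 : expR (- (rate * m%:R)) <= expR (- (rate / 2 * m%:R)).
  by rewrite ler_expR lerN2 ler_wpM2r ?ler0n//; have := rate_gt0; lra.
have b2 : expR (- nblocks) <= expR (- (3 * delta * m%:R)).
  rewrite ler_expR lerN2 /nblocks mulrC ler_wpM2l ?ler0n//.
  have : exponent <= l^-1 by rewrite /exponent !ge_min lexx orbT.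
  by rewrite /delta; have := exponent_gt0; lra.
apply: (@le_trans _ _ (6 * expR (- (3 * delta * m%:R)))).
  apply: le_trans (prob_or p_gt0 _ _) _.
  apply: le_trans (lerD light (prob_or p_gt0 _ _)) _.
  have := prob_or p_gt0 E3 E4; have := heavy; have := poor.
  rewrite -/E2 -/E3; move: t4 b0 b1 b2.
  lra.
have -> : - (delta * m%:R) = - (3 * delta * m%:R) + 2 * delta * m%:R by ring.
rewrite expRD mulrC ler_wpM2l ?expR_ge0//.
apply: le_trans (expR_ge1Dx _); rewrite /delta; lra.
Qed.

End Size.

End BlockLength.

(** L is chosen large first: it must beat the number of sorted words and the number
   of endpoints of a window, both polynomial in L for each block. *)
Lemma normalized_few : exists2 delta : R, 0 < delta & exists N : nat,
  forall m (x : vertex n m) (w0 : m.-tuple 'I_n) (k : nat),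
  pos w0 m = x -> (k.*2 <= m)%N ->
  (forall j, (j < k)%N -> letter i0 w0 j.*2 != letter i0 w0 j.*2.+1) ->
  kappa * m%:R <= k%:R -> (N <= m)%N ->
  prob p (fun om : {ffun vertex n m -> V} => (nmax a x om)%:R <= 2 `^ (delta * m%:R)) <=
  expR (- (delta * m%:R)).
Proof.
have r0 := rate_gt0; have s0 := sparsity_gt0; have d0 := decay_gt0; have D0 := D_gt0.
pose alpha := Num.min (rate / 2) (sparsity * decay).
have a0 : 0 < alpha by rewrite lt_min divr_gt0// mulr_gt0.
have n0 : 0 <= n%:R :> R by exact: ler0n.
have ln20 : 0 <= ln 2 :> R by rewrite ln_ge0//; lra.
have B0 : 0 <= 2 * n%:R * (1 + sparsity) by rewrite !mulr_ge0//; lra.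
have C0 : 0 <= sparsity * D + 2 * ln 2 + 1.
  by have := mulr_gt0 s0 D0; lra.
have [L L0 hL] := logarithm_small a0 B0 C0.
have l1 : 1 <= L%:R :> R by rewrite ler1n.
have ln0 : 0 <= loglen L by rewrite ln_ge0//; lra.
have al1 : alpha * L%:R <= rate / 2 * L%:R by rewrite ler_wpM2r ?ler0n// ge_min lexx.
have al2 : alpha * L%:R <= sparsity * decay * L%:R by rewrite ler_wpM2r ?ler0n// ge_min lexx orbT.
rewrite -/(loglen L) in hL.
have nl0 : 0 <= n%:R * loglen L by rewrite mulr_ge0.
have snl0 : 0 <= sparsity * (n%:R * loglen L) by rewrite mulr_ge0// ltW.
have sD0 := mulr_gt0 s0 D0.
have L_heavy : 2 * n%:R * loglen L <= rate / 2 * L%:R by lra.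
have L_poor : 2 * n%:R * loglen L + 2 * ln 2 + 1 <=
    sparsity * (L%:R * decay - 2 * n%:R * loglen L - D) by lra.
have e0 := exponent_gt0 L0.
exists (delta L); first by rewrite /delta divr_gt0.
exists (L + (Num.truncn (10 / exponent L)).+1)%N => m x w0 k w0x km zig hk Nm.
apply: (prob_few L0 L_heavy L_poor w0x km zig hk).
  by apply: leq_trans Nm; rewrite leq_addr.
rewrite -ler_pdivrMl// mulrC; apply: le_trans (ltW (truncnS_gt _)) _.
by rewrite ler_nat; apply: leq_trans Nm; rewrite leq_addl.
Qed.

End Normalized.

(** * Environments on a finite box *)

Section Finite.
Variables (R : realType) (n : nat) (V : finType) (p th : V -> R).
Hypotheses (n_gt1 : (1 < n)%N) (p_gt0 : forall v, 0 < p v) (p_sum : \sum_v p v = 1).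

Lemma nmax_shift (m : nat) (x : vertex n m) (c : R) :
  nmax (fun v => th v - c) x =1 nmax th x.
Proof.
move=> om; apply: eq_card => w; rewrite !inE /maxword; congr andb.
have e (v : m.-tuple 'I_n) : weight (values (fun v => th v - c) om) v =
    weight (values th om) v - m.+1%:R * c.
  by rewrite /weight /values big_split /= sumrN sumr_const card_ord mulr_natl.
by apply: eq_forallb => v; rewrite !e lerD2r.
Qed.

(** All words with the right endpoint are maximal, in particular the flips of w0. *)
Lemma nmax_constant (i0 : 'I_n) (m : nat) (x : vertex n m) (w0 : m.-tuple 'I_n) (k : nat) om :
  (forall u v, th u = th v) ->
  pos w0 m = x -> (k.*2 <= m)%N ->
  (forall j, (j < k)%N -> letter i0 w0 j.*2 != letter i0 w0 j.*2.+1) ->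
  (2 ^ k <= nmax th x om)%N.
Proof.
move=> cst w0x km zig; rewrite -[X in (2 ^ X)%N](card_ord k) -cardsT.
apply: (card_maxword (i0 := i0) (w := w0) (tau := fun j : 'I_k => (j : nat).*2)).
- rewrite /maxword w0x eqxx; apply/forallP => v; apply/implyP => _.
  by apply: ler_sum => t _; rewrite /values (cst (om _) (om (pos w0 t))).
- move=> j _; rewrite zig//= andbT; apply: leq_trans km.
  by have := ltn_ord j; lia.
- by move=> j _; exact: cst.
- by move=> j j' _ _ /double_inj /ord_inj.
- by move=> j j' _ _; lia.
Qed.

(** Subtracting the smallest weight does not change the maximal paths. *)
Lemma finite_few (beta : R) : 0 < beta -> exists2 delta : R, 0 < delta & exists N : nat,
  forall m (x : vertex n m), level x = m -> (forall i, (x i)%:R <= (1 - beta) * m%:R) ->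
  (N <= m)%N ->
  prob p (fun om : {ffun vertex n m -> V} => (nmax th x om)%:R <= 2 `^ (delta * m%:R)) <=
  expR (- (delta * m%:R)).
Proof.
move=> b0; pose i0 : 'I_n := Ordinal (ltnW n_gt1).
have n0 : 0 < n%:R :> R by rewrite ltr0n ltnW.
pose kappa := Num.min beta 1 / n%:R.
have k0 : 0 < kappa by rewrite divr_gt0// lt_min b0 ltr01.
have k1 : kappa <= 1.
  by rewrite ler_pdivrMr// mul1r ge_min ler1n (ltnW n_gt1) orbT.
have geo m (x : vertex n m) : level x = m -> (forall i, (x i)%:R <= (1 - beta) * m%:R) ->
    exists w0 k, [/\ pos w0 m = x, (k.*2 <= m)%N,
    forall j, (j < k)%N -> letter i0 w0 j.*2 != letter i0 w0 j.*2.+1 & kappa * m%:R <= k%:R].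
  move=> lx hx; have [i [j [ij ji hj]]] := two_long_axes n_gt1 lx hx.
  have [w0 [h1 h2 h3]] := zigzag_word i0 ij ji (leqnn _) lx.
  exists w0, (x j); split=> //; rewrite /kappa mulrAC ler_pdivrMr// mulrC [leRHS]mulrC.
  apply: le_trans hj; rewrite mulrC ler_wpM2r ?ler0n// ge_min lexx//.
case: (boolP [forall u, forall v, th u == th v]) => [/forallP cst|ncst].
  have {}cst u v : th u = th v by move/forallP: (cst u) => /(_ v) /eqP.
  exists (kappa / 2); first by rewrite divr_gt0.
  exists 1 => m x lx hx m1; have [w0 [k [h1 h2 h3 h4]]] := geo m x lx hx.
  rewrite (_ : prob p _ = 0) ?expR_ge0//.
  rewrite -[RHS](Ex_cst (vertex n m) p_sum); apply: eq_Ex => om.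
  have := nmax_constant om cst h1 h2 h3; rewrite -(ler_nat R) natrX => h5.
  rewrite (_ : (_ <= _) = false)//; apply/negbTE; rewrite -ltNge; apply: lt_le_trans h5.
  rewrite -powR_mulrn// /powR pnatr_eq0 /= ltr_expR ltr_pM2r; last by rewrite ln_gt0// ltr1n.
  have m0 : 0 < m%:R :> R by rewrite ltr0n.
  have := mulr_gt0 k0 m0; lra.
have [v0 _] : exists v : V, true.
  by move: ncst => /forallPn[u _]; exists u.
pose vmin := [arg min_(v < v0) th v]%O; pose vmax := [arg max_(v > v0) th v]%O.
have hmin v : th vmin <= th v by rewrite /vmin; case: arg_minP => // u _; apply.
have hmax v : th v <= th vmax by rewrite /vmax; case: arg_maxP => // u _; apply.
pose a v := th v - th vmin.
have D0 : 0 < a vmax.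
  rewrite subr_gt0 lt_neqAle hmin andbT; apply: contra ncst => /eqP e.
  apply/forallP => u; apply/forallP => v; apply/eqP/le_anti.
  by rewrite (le_trans (hmax u)) -?e//= (le_trans (hmax v)) -?e.
have a_ge0 v : 0 <= a v by rewrite subr_ge0.
have a_le v : a v <= a vmax by rewrite lerD2r.
have amin : a vmin = 0 by rewrite /a subrr.
have [delta d0 [N hN]] := normalized_few i0 p_gt0 p_sum amin erefl D0 a_ge0 a_le k0 k1.
exists delta => //; exists N => m x lx hx Nm; have [w0 [k [h1 h2 h3 h4]]] := geo m x lx hx.
apply: le_trans (hN m x w0 k h1 h2 h3 h4 Nm).
by apply: (le_prob p_gt0) => om; rewrite nmax_shift.
Qed.

End Finite.

(** * Lattice paths and cylinder events *)

Local Open Scope classical_set_scope.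

Section PathsAsWords.
Variables (n m : nat) (i0 : 'I_n).
Notation word := (m.-tuple 'I_n).
Notation vertex := (vertex n m).
Implicit Types (w : word).

Definition site_of (y : vertex) : site n := \row_i (y i)%:Z.

Lemma site_of_inj : injective site_of.
Proof.
move=> y z /rowP e; apply/ffunP => i; apply/ord_inj.
by have := e i; rewrite !mxE => -[].
Qed.

Definition path_of (w : word) : seq (site n) :=
  site_of (pos w 0) :: mkseq (fun t => site_of (pos w t.+1)) m.

Lemma size_path_of w : size (path_of w) = m.+1.
Proof. by rewrite /= size_mkseq. Qed.

Lemma nth_path_of w t : (t <= m)%N -> nth 0 (path_of w) t = site_of (pos w t).
Proof. by case: t => //= t tm; rewrite nth_mkseq. Qed.

Lemma path_of_inj : injective path_of.
Proof.
move=> v w e; have {}e t : (t <= m)%N -> pos v t = pos w t.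
  by move=> tm; apply: site_of_inj; rewrite -!nth_path_of// e.
apply: (letter_inj (i0 := i0)) => t tm.
have /eqP/pos_eqP c1 := e t (ltnW tm); have /eqP/pos_eqP c2 := e _ tm.
have := c2 (letter i0 v t); rewrite !(cntS i0)// c1 eqxx => /addnI.
by case: eqP.
Qed.

Lemma site_of_step w t : (t < m)%N ->
  site_of (pos w t.+1) = site_of (pos w t) + delta_mx 0 (letter i0 w t).
Proof.
move=> tm; apply/rowP => i; rewrite !mxE !pos_cntE. rewrite (cntS i0)// eqxx /= PoszD.
by rewrite eq_sym; case: eqP.
Qed.

Lemma site_of0 w : site_of (pos w 0) = 0.
Proof. by apply/rowP => i; rewrite !mxE pos_cntE cnt0. Qed.

Lemma directed_path_of w : directed_path 0 (site_of (pos w m)) (path_of w).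
Proof.
have sz := size_mkseq (fun t => site_of (pos w t.+1)) m.
rewrite /directed_path /path_of site_of0 eqxx /=; apply/andP; split.
  apply/(pathP 0) => t; rewrite sz => tm.
  have := nth_path_of w (ltnW tm); rewrite /path_of site_of0 => ->.
  rewrite nth_mkseq// (site_of_step w tm) /step; apply/existsP; exists (letter i0 w t).
  by rewrite addrC addKr.
by have := nth_path_of w (leqnn m); rewrite /path_of site_of0 (last_nth 0) sz => ->.
Qed.

(** The sum of the coordinates grows by one at each step, so all the paths to y
   have m steps. *)
Lemma directed_pathP (y : vertex) s : level y = m -> directed_path 0 (site_of y) s ->
  exists2 w, pos w m = y & s = path_of w.
Proof.
case: s => //= z s ly /and3P[/eqP -> ps /eqP ls].
have cs : coord_sum (site_of y) = m%:Z.
  rewrite /coord_sum /site_of -[in RHS]ly /level (big_morph Posz PoszD (erefl _)).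
  by apply: eq_bigr => i _; rewrite mxE.
have c0 : coord_sum (0 : site n) = 0.
  by rewrite /coord_sum big1// => i _; rewrite mxE.
have sz : size s = m.
  by have := coord_sum_path ps; rewrite ls cs c0 add0r => -[].
pose f (t : nat) := odflt i0 [pick i | nth 0 s t - nth 0 ((0 : site n) :: s) t == delta_mx 0 i].
have fE t : (t < m)%N -> nth 0 s t = nth 0 ((0 : site n) :: s) t + delta_mx 0 (f t).
  rewrite -sz => tm; have /(pathP 0)/(_ t tm)/existsP[i hi] := ps.
  rewrite /f; case: pickP => [j /eqP <-|/(_ i)]; last by rewrite hi.
  by rewrite addrC subrK.
pose w : word := [tuple f t | t < m].
have lw t : (t < m)%N -> letter i0 w t = f t.
  by move=> tm; rewrite /letter -(tnth_nth i0 w (Ordinal tm)) tnth_mktuple.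
have posw t : (t <= m)%N -> site_of (pos w t) = nth 0 ((0 : site n) :: s) t.
  elim: t => [_|t IH tm]; first by rewrite site_of0.
  by rewrite site_of_step// IH 1?ltnW// lw// -fE.
exists w; first by apply: site_of_inj; rewrite posw// -ls (last_nth 0) sz.
apply: (@eq_from_nth _ 0) => [|t]; first by rewrite size_path_of /= sz.
by rewrite /= sz ltnS => tm; rewrite nth_path_of// posw.
Qed.

Lemma path_weight_of (R : realType) (f : site n -> R) w :
  path_weight f (path_of w) = weight (f \o site_of) w.
Proof.
rewrite /path_weight (big_nth 0) size_path_of big_mkord; apply: eq_bigr => t _.
by rewrite nth_path_of// -ltnS.
Qed.

Lemma maximal_path_ofP (R : realType) (f : site n -> R) (y : vertex) : level y = m ->
  maximal_paths f (site_of y) = path_of @` [set w | maxword (f \o site_of) y w].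
Proof.
move=> ly; apply/seteqP; split => [s [ds smax]|_ [w /andP[/eqP wy /forallP wmax] <-]].
  have [w wy sw] := directed_pathP ly ds; exists w => //=.
  rewrite /maxword wy eqxx; apply/forallP => v; apply/implyP => /eqP vy.
  rewrite -!path_weight_of -sw; apply: smax; rewrite -vy; exact: directed_path_of.
split=> [|s' /(directed_pathP ly)[v vy ->]]; first by rewrite -wy; exact: directed_path_of.
by rewrite !path_weight_of; have := wmax v; rewrite vy eqxx.
Qed.

Lemma nb_maximal_path_of (R : realType) (f : site n -> R) (y : vertex) : level y = m ->
  nb_maximal_paths f (site_of y) = #|[pred w : word | maxword (f \o site_of) y w]|.
Proof.
move=> ly; rewrite /nb_maximal_paths maximal_path_ofP//.
rewrite fset_set_image; last exact: finite_finset.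
rewrite card_imfset; last exact: path_of_inj.
rewrite -card_finset; congr (#|` _ |%fset); apply/fsetP => w.
by rewrite in_fset_set ?inE//; [apply/idP/idP; rewrite inE|exact: finite_finset].
Qed.

End PathsAsWords.

Section Cylinders.
Variables (R : realType) (n m : nat).
Notation vertex := (vertex n m).
Variables (d : measure_display) (T : measurableType d) (P : probability T R)
  (omega : site n -> {RV P >-> R}).
Variables (V : finType) (th : V -> R).
Notation config := {ffun vertex -> V}.

Definition cylinder (om : config) : set T :=
  [set t | forall y, omega (site_of y) t = th (om y)].

Lemma cylinderE om : cylinder om =
  \bigcap_(z in [set` [fset site_of y | y : vertex]%fset])
    (omega z @^-1` [set r | exists2 y, site_of y = z & r = th (om y)]).
Proof.
apply/seteqP; split => [t ht z /= /imfsetP[y _ ->]|t ht y]; first by exists y.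
have /ht [y' /site_of_inj -> //] : (site_of y \in [fset site_of y | y : vertex]%fset).
by apply/imfsetP; exists y.
Qed.

Lemma value_set1 om (y : vertex) :
  [set r | exists2 y', site_of y' = site_of y & r = th (om y')] = [set th (om y)].
Proof.
apply/seteqP; split => [r [y' /site_of_inj -> ->]//|r ->]; by exists y.
Qed.

Lemma measurable_cylinder om : measurable (cylinder om).
Proof.
rewrite cylinderE; apply: fin_bigcap_measurable => // z /= /imfsetP[y _ ->].
rewrite value_set1 -[X in measurable X]setTI.
by apply: measurable_funP.
Qed.

Lemma prob_cylinder (mu : probability (measurableTypeR R) R) om :
  mutually_independent omega ->
  (forall x B, measurable B -> distribution P (omega x) B = mu B) ->
  P (cylinder om) = (\prod_y mu [set th (om y)])%E.
Proof.
move=> indep ident; rewrite cylinderE indep; last first.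
  by move=> z /imfsetP[y _ ->]; rewrite value_set1; exact: measurable_set1.
rewrite big_imfset /=; last by move=> y z _ _; exact: site_of_inj.
rewrite big_enum /=; apply: eq_bigr => y _.
by rewrite value_set1; apply: (ident (site_of y)); exact: measurable_set1.
Qed.

(** Finitely many sites with finitely many values: the event is a finite union of
   cylinders, hence measurable. *)
Lemma event_cylinders (E : set T) :
  (forall (y : vertex) t, exists v, omega (site_of y) t = th v) ->
  (forall t t', (forall y : vertex, omega (site_of y) t = omega (site_of y) t') -> E t -> E t') ->
  E = \big[setU/set0]_(om : config | `[< exists2 t, cylinder om t & E t >]) cylinder om.
Proof.
move=> vals dep; apply/seteqP; split => [t Et|t].
  have /choice[h ht] : forall y : vertex, exists v, omega (site_of y) t = th v by move=> y; exact: vals.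
  rewrite -bigcup_seq_cond; exists [ffun y => h y] => /=.
    rewrite mem_index_enum; apply/asboolP; exists t => // y; by rewrite ffunE.
  by move=> y; rewrite ffunE.
rewrite -bigcup_seq_cond => -[om /=]; rewrite mem_index_enum /= => /asboolP[t' ct' Et'] ct.
by apply: dep Et' => y; rewrite ct ct'.
Qed.

Lemma le_prob_cylinders (E : set T) :
  (forall (y : vertex) t, exists v, omega (site_of y) t = th v) ->
  (forall t t', (forall y : vertex, omega (site_of y) t = omega (site_of y) t') -> E t -> E t') ->
  (P E <= \sum_(om : config | `[< exists2 t, cylinder om t & E t >]) P (cylinder om))%E.
Proof.
move=> vals dep; rewrite {1}(event_cylinders vals dep).
elim: (index_enum _) => [|om s IH]; first by rewrite !big_nil measure0.
rewrite !big_cons; case: ifP => // _; apply: (le_trans (measureU2 P _ _)).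
- exact: measurable_cylinder.
- by apply: bigsetU_measurable => om' _; exact: measurable_cylinder.
- exact: leeD2l.
Qed.

End Cylinders.

(** * From the random field to the finite box *)

Section Atoms.
Variables (R : realType) (Theta : set R) (mu : probability (measurableTypeR R) R).
Hypothesis Theta_fin : finite_set Theta.

Definition mass (v : fset_set Theta) : R := fine (mu [set (\val v : R)]).

Lemma massE v : mu [set (\val v : R)] = (mass v)%:E.
Proof. by rewrite fineK// fin_num_measure//; exact: measurable_set1. Qed.

Lemma mass_ge0 v : 0 <= mass v.
Proof. by rewrite fine_ge0. Qed.

Lemma Theta_bigU : Theta = \big[setU/set0]_(v <- fset_set Theta) [set v].
Proof. by rewrite -bigcup_fset -[in LHS](fset_setK Theta_fin); apply/seteqP; split => [v hv|v [u hu ->//]]; exists v. Qed.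

Lemma measurable_Theta : measurable (Theta : set (measurableTypeR R)).
Proof. by rewrite Theta_bigU; apply: bigsetU_measurable => v _; exact: measurable_set1. Qed.

Lemma sum_mass : mu Theta = (\sum_v mass v)%:E.
Proof.
rewrite {1}Theta_bigU measure_fbigsetU.
- by rewrite big_seq_fsetE /= -sumEFin; apply: eq_bigr => v _; rewrite massE.
- by move=> v _; exact: measurable_set1.
- by move=> u v _ _ [r [/= -> ->]].
Qed.

(** Values of mass zero are discarded, so that resampling a site costs a bounded
   factor. *)
Definition atom : finType := {v : fset_set Theta | 0 < mass v}.

Definition atom_value (v : atom) : R := \val (\val v).
Definition atom_mass (v : atom) : R := mass (\val v).

Lemma atom_mass_gt0 v : 0 < atom_mass v. Proof. exact: (valP v). Qed.

Lemma sum_atom_mass : \sum_v atom_mass v = \sum_v mass v.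
Proof.
rewrite [RHS](bigID (fun v => 0 < mass v)) /= [X in _ + X]big1 ?addr0; last first.
  by move=> v; rewrite -leNgt => h; apply/eqP; rewrite eq_le h mass_ge0.
rewrite [RHS](reindex_omap (fun v : atom => \val v) insub) /=.
  by apply: eq_bigl => v; rewrite (valP v) valK eqxx.
by move=> v hv; rewrite insubT.
Qed.

Lemma sum_configs (X : finType) (F : pred {ffun X -> fset_set Theta}) (G : pred {ffun X -> atom}) :
  \sum_v atom_mass v = 1 ->
  (forall om : {ffun X -> atom}, F [ffun y => \val (om y)] -> G om) ->
  \sum_(h : {ffun X -> fset_set Theta} | F h) \prod_y mass (h y) <= prob atom_mass G.
Proof.
move=> s1 FG.
have [v0 _] : exists v0 : atom, true.
  case: (pickP (fun _ : atom => true)) => [v0 _|h]; first by exists v0.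
  by move: s1; rewrite big1 => [/eqP|v _]; [rewrite eq_sym oner_eq0|have := h v].
rewrite (bigID (fun h : {ffun X -> fset_set Theta} => [forall y, 0 < mass (h y)])) /=.
rewrite [X in _ + X]big1 ?addr0; last first.
  move=> h /andP[_ /forallPn[y]]; rewrite -leNgt => hy; rewrite (bigD1 y)//=.
  have -> : mass (h y) = 0 by apply/eqP; rewrite eq_le hy mass_ge0.
  by rewrite mul0r.
rewrite (reindex_onto (fun om : {ffun X -> atom} => [ffun y => \val (om y)])
  (fun h => [ffun y => insubd v0 (h y)])) /=; last first.
  move=> h /andP[_ /forallP hp]; apply/ffunP => y; rewrite !ffunE.
  by rewrite val_insubd hp.
rewrite /prob /Ex big_mkcond; apply: ler_sum => om _.
have p0 : 0 <= Pr atom_mass om by apply: Pr_ge0; exact: atom_mass_gt0.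
case: ifP => [/andP[/andP[/FG -> _] _]|_]; last by rewrite mulr_ge0// ler0n.
by rewrite mulr1 le_eqVlt; apply/orP; left; apply/eqP/eq_bigr => y _; rewrite ffunE.
Qed.

End Atoms.

Lemma nb_maximal_paths_values (R : realType) (n m : nat) (i0 : 'I_n) (V : finType) (th : V -> R)
    (f : site n -> R) (x : vertex n m) (om : {ffun vertex n m -> V}) : level x = m ->
  (forall y, f (site_of y) = th (om y)) -> nb_maximal_paths f (site_of x) = nmax th x om.
Proof.
move=> lx e; rewrite (nb_maximal_path_of i0)// /nmax cardsE; apply: eq_card => w.
by rewrite !unfold_in; apply: eq_maxword.
Qed.

Lemma nb_maximal_paths_agree (R : realType) (n m : nat) (i0 : 'I_n) (f f' : site n -> R)
    (x : vertex n m) : level x = m -> (forall y : vertex n m, f (site_of y) = f' (site_of y)) ->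
  nb_maximal_paths f (site_of x) = nb_maximal_paths f' (site_of x).
Proof.
move=> lx e; rewrite !(nb_maximal_path_of i0)//; apply: eq_card => w.
by rewrite !unfold_in; apply: eq_maxword.
Qed.

Lemma vertex_of_site (n : nat) (x : site n) : (forall i, 0 <= x ord0 i) ->
  exists y : vertex n (l1norm x), [/\ site_of y = x, level y = l1norm x &
    forall i, y i = `|x ord0 i|%N :> nat].
Proof.
move=> x0; pose y : vertex n (l1norm x) := [ffun i => inord `|x ord0 i|%N].
have yE i : y i = `|x ord0 i|%N :> nat.
  by rewrite ffunE inordK// ltnS /l1norm (bigD1 i)//= leq_addr.
exists y; split=> //; first by apply/rowP => i; rewrite mxE yE gez0_abs.
by apply: eq_bigr => i _; rewrite yE.
Qed.

Theorem theorem2 (R : realType) (n : nat) (hn : (2 <= n)%N)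
    (Theta : set R) (hTheta : finite_set Theta)
    (mu : probability (measurableTypeR R) R) (beta : R) (hbeta : 0 < beta) :
  exists2 delta : R, 0 < delta &
    forall (d : measure_display) (T : measurableType d) (P : probability T R)
      (omega : site n -> {RV P >-> R}),
    (forall x t, Theta (omega x t)) ->
    mutually_independent omega ->
    (forall x B, measurable B -> distribution P (omega x) B = mu B) ->
    exists N : nat, forall x : site n, cone beta x -> (N <= l1norm x)%N ->
      (P [set t | ((nb_maximal_paths (fun z => omega z t) x)%:R
                     <= 2 `^ (delta * (l1norm x)%:R))%R]
       <= (expR (- (delta * (l1norm x)%:R)))%:E)%E.
Proof.
pose p := @atom_mass R Theta mu; pose th := @atom_value R Theta mu.
have [s1|s1] := eqVneq (\sum_v p v) 1; last first.
  (* then mu does not charge Theta fully and there is no such family omega *)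
  exists 1 => // d T P omega vals _ ident; exfalso; move/eqP: s1; apply.
  rewrite sum_atom_mass; apply: EFin_inj; rewrite -sum_mass//.
  rewrite -(ident 0) /distribution /pushforward; last exact: measurable_Theta.
  rewrite (_ : omega 0 @^-1` Theta = setT) ?probability_setT//.
  by apply/seteqP; split=> // t _; exact: vals.
have [delta d0 [N hN]] := finite_few th hn (@atom_mass_gt0 R Theta mu) s1 hbeta.
exists delta => // d T P omega vals indep ident; exists N => x xcone Nx.
have i0 : 'I_n := Ordinal (ltnW hn).
have [y [yx ly yi]] := vertex_of_site (fun i => proj1 (xcone i)).
set c := 2 `^ _; set E := [set t | _].
have vals' (z : vertex n (l1norm x)) t : exists v : fset_set Theta, omega (site_of z) t = \val v.
  have h : omega (site_of z) t \in fset_set Theta by rewrite in_fset_set// inE; exact: vals.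
  by exists [` h]%fset.
have dep t t' : (forall z : vertex n (l1norm x), omega (site_of z) t = omega (site_of z) t') ->
    E t -> E t'.
  move=> e; rewrite /E /=; suff -> : nb_maximal_paths (fun z => omega z t) x =
    nb_maximal_paths (fun z => omega z t') x by [].
  by rewrite -yx; apply: nb_maximal_paths_agree.
apply: le_trans (le_prob_cylinders vals' dep) _.
under eq_bigr => h _ do [rewrite (prob_cylinder _ h indep ident);
  under eq_bigr do rewrite massE; rewrite prodEFin].
rewrite sumEFin lee_fin.
pose G (om : {ffun vertex n (l1norm x) -> atom Theta mu}) := (nmax th y om)%:R <= c.
apply: (@le_trans _ _ (prob p G)).
  apply: (sum_configs (G := G)) => // om /asboolP[t ct].
  rewrite /E /G /=; suff -> : nb_maximal_paths (fun z => omega z t) x = nmax th y om by [].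
  by rewrite -[in LHS]yx; apply: nb_maximal_paths_values => // z; rewrite ct ffunE.
apply: hN => // i; have [x0 h] := xcone i.
by rewrite yi natr_absz ger0_norm.
Qed.
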